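(* Let $\tau$ be a structure with a space-rooted metrization $\tau^{\mathrm{srm}}$. Assume that $\tau$ is embedding-continuous and upper semicontinuous. If $\tau^{\mathrm{srm}}$ is complete, then $d_{\mathfrak{M}_\bullet}^{\tau^{\mathrm{srm}}}$ is a complete metric on $\mathfrak{M}_\bullet(\tau)$.
   Context: A bcm (boundedly-compact metric) space is a non-empty metric space in which every closed ball of finite radius is compact; a rooted bcm space $(X,\rho_X)$ is a bcm space $X$ with a distinguished point $\rho_X$. The metric of $X$ is denoted $d_X$, and $D_X(x,r)=\{y: d_X(x,y)\le r\}$. An isometric embedding is a distance-preserving map (not necessarily onto); an isometry is a bijective one; a map is root-preserving if it sends root to root. A topological embedding is a homeomorphism onto its image. Structure: a functor $\tau$ from the category of bcm spaces (morphisms: isometric embeddings) to the category of metrizable topological spaces (morphisms: topological embeddings). That is, to each bcm space $X$ it assigns a metrizable space $\tau(X)$ and to each isometric embedding $f\colon X\to Y$ a topological embedding $\tau_f\colon\tau(X)\to\tau(Y)$, with $\tau_{\mathrm{id}_X}=\mathrm{id}_{\tau(X)}$ and $\tau_{g\circ f}=\tau_g\circ\tau_f$. When $X$ is isometrically embedded into $Y$ by $f$, $\tau(X)$ is regarded as a subspace of $\tau(Y)$ via $\tau_f$. $\tau$ is embedding-continuous if, whenever $X,Y$ are bcm spaces and $f_n\colon X\to Y$, $n\in\mathbb{N}\cup\{\infty\}$, are isometric embeddings with $f_n\to f_\infty$ uniformly on compact sets, one has $\tau_{f_n}(a)\to\tau_{f_\infty}(a)$ in $\tau(Y)$ for all $a\in\tau(X)$.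 $\tau$ is upper semicontinuous if, whenever bcm spaces $X_n$, $n\in\mathbb{N}\cup\{\infty\}$, are isometrically embedded into a common bcm space $Y$ so that $X_n\to X_\infty$ in the Fell topology as subsets of $Y$, and $a_n\in\tau(X_n)$ converge to some $a\in\tau(Y)$, then $a\in\tau(X_\infty)$. Here the Fell topology on closed subsets of $Y$ is generated by the sets $\{A: A\cap K=\emptyset\}$ ($K$ compact) and $\{A: A\cap U\ne\emptyset\}$ ($U$ open). $\mathfrak{M}_\bullet(\tau)$: the set of (representatives of) equivalence classes of triples $(X,\rho_X,a_X)$, with $(X,\rho_X)$ a rooted bcm space and $a_X\in\tau(X)$, where $(X,\rho_X,a_X)\sim(Y,\rho_Y,a_Y)$ iff there is a root-preserving isometry $f\colon X\to Y$ with $\tau_f(a_X)=a_Y$. Space-rooted metrization $\tau^{\mathrm{srm}}$ of $\tau$: a choice, for each rooted bcm space $(X,\rho_X)$, of a metric $d^{\tau^{\mathrm{srm}}}_{X,\rho_X}$ on $\tau(X)$ inducing the given topology of $\tau(X)$, such that for every root-preserving isometric embedding $f\colon(X,\rho_X)\to(Y,\rho_Y)$ the map $\tau_f$ is distance-preserving. It is complete if every $d^{\tau^{\mathrm{srm}}}_{X,\rho_X}$ is a complete metric. Hausdorff metric on compact subsets (including $\emptyset$) of a metric space $M$: $d^H_M(A,B)=\inf\{\varepsilon\ge0: A\subseteq B^\varepsilon, B\subseteq A^\varepsilon\}$, where $A^\varepsilon=\{x:\exists y\in A, d_M(x,y)\le\varepsilon\}$ and $\inf\emptyset=\infty$. For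 a rooted bcm space $(M,\rho)$ and closed $A,B\subseteq M$, $$d^F_{M,\rho}(A,B)=\int_0^\infty e^{-r}\bigl(1\wedge d^H_M(A\cap D_M(\rho,r),B\cap D_M(\rho,r))\bigr)dr.$$ For $\mathcal{X}=(X,\rho_X,a_X)$, $\mathcal{Y}=(Y,\rho_Y,a_Y)$ in $\mathfrak{M}_\bullet(\tau)$, $$d_{\mathfrak{M}_\bullet}^{\tau^{\mathrm{srm}}}(\mathcal{X},\mathcal{Y})=\inf_{f,g,Z}\bigl\{d^F_{Z,\rho_Z}(f(X),g(Y))\vee d^{\tau^{\mathrm{srm}}}_{Z,\rho_Z}(\tau_f(a_X),\tau_g(a_Y))\bigr\},$$ the infimum being over all rooted bcm spaces $(Z,\rho_Z)$ and root-preserving isometric embeddings $f\colon X\to Z$, $g\colon Y\to Z$. *)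

(* Defs.v *)
From HB Require Import structures.
From mathcomp Require Import all_boot all_order all_algebra.
From mathcomp Require Import all_classical all_reals all_analysis.

Set Implicit Arguments.
Unset Strict Implicit.
Unset Printing Implicit Defensive.

Import Order.TTheory GRing.Theory Num.Theory.
Import numFieldTopology.Exports.

Local Open Scope classical_set_scope.
Local Open Scope ring_scope.

Record is_metric (R : realType) (T : Type) (d : T -> T -> R) : Prop := IsMetric {
  is_metric_ge0 : forall x y, 0 <= d x y ;
  is_metric_eq0 : forall x y, d x y = 0 <-> x = y ;
  is_metric_sym : forall x y, d x y = d y x ;
  is_metric_triangle : forall x y z, d x z <= d x y + d y z }.

Definition complete_metric (R : realType) (T : Type) (d : T -> T -> R) : Prop :=
  forall u : nat -> T,
    (forall e : R, 0 < e ->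
      exists N, forall m n, (N <= m)%N -> (N <= n)%N -> d (u m) (u n) < e) ->
    exists l : T,
      forall e : R, 0 < e -> exists N, forall n, (N <= n)%N -> d (u n) l < e.

Definition induces_topology (R : realType) (T : topologicalType)
    (d : T -> T -> R) : Prop :=
  forall A : set T,
    open A <->
    (forall x, A x -> exists2 e : R, 0 < e & [set y | d x y < e] `<=` A).

Definition metrizable (R : realType) (T : topologicalType) : Prop :=
  exists d : T -> T -> R, is_metric d /\ induces_topology d.

Record topological_embedding (S T : topologicalType) (f : S -> T) : Prop := {
  topological_embedding_inj : injective f ;
  topological_embedding_continuous : continuous f ;
  topological_embedding_open : forall U : set S, open U ->
    exists2 V : set T, open V & f @` U = V `&` range f }.

Record bcm (R : realType) := Bcm {
  bcm_metric :> metricType R ;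
  bcm_nonempty : [set: bcm_metric] !=set0 ;
  bcm_compact_ball : forall (x : bcm_metric) (r : R),
    compact [set y | mdist x y <= r] }.

Definition cball (R : realType) (X : bcm R) (x : X) (r : R) : set X :=
  [set y | mdist x y <= r].

Record iso_emb (R : realType) (X Y : bcm R) := IsoEmb {
  iso_emb_fun :> X -> Y ;
  iso_emb_mdist : forall x y, mdist (iso_emb_fun x) (iso_emb_fun y) = mdist x y }.

Definition iso_emb_id (R : realType) (X : bcm R) : iso_emb X X :=
  @IsoEmb R X X idfun (fun _ _ => erefl).

Lemma iso_emb_comp_mdist (R : realType) (X Y Z : bcm R)
    (g : iso_emb Y Z) (f : iso_emb X Y) (x y : X) :
  mdist ((g \o f) x) ((g \o f) y) = mdist x y.
Proof. by rewrite /= !iso_emb_mdist. Qed.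

Definition iso_emb_comp (R : realType) (X Y Z : bcm R)
    (g : iso_emb Y Z) (f : iso_emb X Y) : iso_emb X Z :=
  IsoEmb (iso_emb_comp_mdist g f).

Record structure (R : realType) := Structure {
  structure_obj :> bcm R -> topologicalType ;
  structure_map : forall X Y : bcm R,
    iso_emb X Y -> structure_obj X -> structure_obj Y ;
  structure_metrizable : forall X, metrizable R (structure_obj X) ;
  structure_embedding : forall X Y (f : iso_emb X Y),
    topological_embedding (structure_map f) ;
  structure_map_id : forall X a, structure_map (iso_emb_id X) a = a ;
  structure_map_comp : forall X Y Z (g : iso_emb Y Z) (f : iso_emb X Y) a,
    structure_map (iso_emb_comp g f) a = structure_map g (structure_map f a) }.

Arguments structure_map {R} tau {X Y} f a : rename.

Definition embedding_continuous (R : realType) (tau : structure R) : Prop :=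
  forall (X Y : bcm R) (f : nat -> iso_emb X Y) (foo : iso_emb X Y),
    (forall K : set X, compact K ->
      {uniform K, (fun n => f n : X -> Y) @ \oo --> (foo : X -> Y)}) ->
    forall a : tau X,
      (fun n => structure_map tau (f n) a) @ \oo --> structure_map tau foo a.

Record fell (T : topologicalType) := Fell {
  fell_set :> set T ;
  fell_closed : closed fell_set }.

Definition fell_subbase (T : topologicalType) : set (set (fell T)) :=
  [set W | (exists2 K : set T, compact K & W = [set A : fell T | A `&` K = set0])
        \/ (exists2 U : set T, open U & W = [set A : fell T | A `&` U !=set0])].

HB.instance Definition _ (T : topologicalType) := gen_eqMixin (fell T).
HB.instance Definition _ (T : topologicalType) := gen_choiceMixin (fell T).
HB.instance Definition _ (T : topologicalType) :=
  @isSubBaseTopological.Build (fell T) (set (fell T)) (@fell_subbase T) id.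

Lemma iso_emb_continuous (R : realType) (X Y : bcm R) (f : iso_emb X Y) :
  continuous f.
Proof.
move=> x; apply/metricType_numDomainType.cvgrPdist_lt => e e0.
under eq_near => t do rewrite iso_emb_mdist.
by apply/metricType_numDomainType.nbhs_mdistP; exists e.
Qed.

Lemma closed_range_iso_emb (R : realType) (X Y : bcm R) (f : iso_emb X Y) :
  closed (range f).
Proof.
have [x0 _] := bcm_nonempty X.
move=> y fy; pose r := mdist (f x0) y + 1.
have cK : compact (f @` cball x0 r).
  apply: continuous_compact; last exact: bcm_compact_ball.
  by apply: continuous_subspaceT; exact: iso_emb_continuous.
suff [x _ <-] : (f @` cball x0 r) y by exists x.
apply: (compact_closed (@metric_hausdorff R Y) cK) => B By.
have B1 : nbhs y (ball y 1) by exact: nbhsx_ballx.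
have [_ [[x _ <-] [Bx]]] := fy _ (filterI By B1).
rewrite ballEmdist /= => yx; exists (f x); split => //; exists x => //.
rewrite /cball /= -(iso_emb_mdist f) /r.
by rewrite (le_trans (metric_triangle _ y _))// lerD2l ltW.
Qed.

Definition fell_range (R : realType) (X Y : bcm R) (f : iso_emb X Y) : fell Y :=
  Fell (@closed_range_iso_emb R X Y f).

Definition upper_semicontinuous (R : realType) (tau : structure R) : Prop :=
  forall (Y : bcm R) (X : nat -> bcm R) (Xoo : bcm R)
         (f : forall n, iso_emb (X n) Y) (foo : iso_emb Xoo Y),
    (fun n => fell_range (f n)) @ \oo --> fell_range foo ->
    forall (a : forall n, tau (X n)) (b : tau Y),
      (fun n => structure_map tau (f n) (a n)) @ \oo --> b ->
      range (structure_map tau foo) b.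

Record srm (R : realType) (tau : structure R) := Srm {
  srm_dist : forall (X : bcm R) (rho : X), tau X -> tau X -> R ;
  srm_metric : forall (X : bcm R) (rho : X), is_metric (srm_dist rho) ;
  srm_topology : forall (X : bcm R) (rho : X), induces_topology (srm_dist rho) ;
  srm_map : forall (X Y : bcm R) (rhoX : X) (rhoY : Y) (f : iso_emb X Y),
    f rhoX = rhoY -> forall a b,
    srm_dist rhoY (structure_map tau f a) (structure_map tau f b) =
    srm_dist rhoX a b }.

Definition srm_complete (R : realType) (tau : structure R) (s : srm tau) : Prop :=
  forall (X : bcm R) (rho : X), complete_metric (srm_dist s rho).

Definition thicken (R : realType) (M : metricType R) (A : set M) (e : R) : set M :=
  [set x | exists2 y, A y & mdist x y <= e].

(* [ereal_inf set0 = +oo], so the distance from [set0] to a nonempty set is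
   infinite. *)
Definition dH (R : realType) (M : metricType R) (A B : set M) : \bar R :=
  ereal_inf [set e%:E | e in
    [set e : R | [/\ 0 <= e, A `<=` thicken B e & B `<=` thicken A e]]].

Definition dF (R : realType) (M : bcm R) (rho : M) (A B : set M) : \bar R :=
  (\int[@lebesgue_measure R]_(r in `[0%R, +oo[)
    ((expR (- r))%:E *
     Order.min 1 (dH (A `&` cball rho r) (B `&` cball rho r))))%E.

Record triple (R : realType) (tau : structure R) := Triple {
  tspace : bcm R ;
  troot : tspace ;
  tpoint : tau tspace }.

Definition tequiv (R : realType) (tau : structure R) (x y : triple tau) : Prop :=
  exists f : iso_emb (tspace x) (tspace y),
    [/\ bijective f, f (troot x) = troot y &
        structure_map tau f (tpoint x) = tpoint y].

(* A hand-made type of equivalence classes: [triple] is a large type, and using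
   the library's [set] or [{eq_quot _}] on it would constrain their universes to
   lie strictly above the one of the carriers of metric spaces. *)
Record frakM (R : realType) (tau : structure R) := FrakM {
  frakM_class : triple tau -> Prop ;
  frakM_classP : exists x, frakM_class = tequiv x }.

Definition frakM_repr (R : realType) (tau : structure R) (c : frakM tau) :
    triple tau :=
  sval (cid (frakM_classP c)).

Definition dtriple (R : realType) (tau : structure R) (s : srm tau)
    (x y : triple tau) : \bar R :=
  ereal_inf [set z : \bar R |
    exists (Z : bcm R) (rho : Z) (f : iso_emb (tspace x) Z)
           (g : iso_emb (tspace y) Z),
      [/\ f (troot x) = rho, g (troot y) = rho &
          z = Order.max (dF rho (range f) (range g))
                (srm_dist s rho (structure_map tau f (tpoint x))
                                (structure_map tau g (tpoint y)))%:E]].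

Definition dfrakM (R : realType) (tau : structure R) (s : srm tau)
    (c1 c2 : frakM tau) : \bar R :=
  dtriple s (frakM_repr c1) (frakM_repr c2).

(* Main.v *)
From HB Require Import structures.
Require Import Defs.
From mathcomp Require Import all_boot all_order all_algebra.
From mathcomp Require Import all_classical all_reals all_analysis.
From mathcomp Require Import measurable_realfun lra zify.

(* The whole theorem rests on one construction.  A sequence of rooted spaces
   [X n] with prescribed couplings of [X n] and [X n.+1] is glued into a single
   metric: the distance is the infimum of the lengths of chains, and a chain
   between consecutive levels can be shortened by deleting its highest and
   lowest vertices, so the prescribed distances are not altered.  If the
   couplings improve geometrically, the completion [Z] is boundedly compact.
   A coupling that is optimal up to [e] only depends on the cross distances (the
   structure is functorial), so its cost can be read in [Z].
   - The sequence x, y, z, z, ... gives the triangle inequality, and x, y, y, ...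
     with the wedge of x and y at their roots gives finiteness.
   - For a fast Cauchy sequence, the images of [X n] converge in [Z] to a closed
     set [A] and the images of the points converge in [tau Z], which is complete;
     by upper semicontinuity the limit lies in [tau A], and this is the limit.
   - If x and y are at distance 0, use x, y, x, y, ...: the embeddings of x and
     those of y subconverge by Arzela-Ascoli to embeddings onto the same [A], and
     embedding continuity matches the points. *)

Set Implicit Arguments.
Unset Strict Implicit.
Unset Printing Implicit Defensive.

Import Order.TTheory GRing.Theory Num.Theory.
Import numFieldTopology.Exports.

Local Open Scope classical_set_scope.
Local Open Scope ring_scope.

(** * Metric spaces, compactness and subspaces *)

Section MetricOf.
Variables (R : realType) (T : Type) (d : T -> T -> R).

(** The proof that [d] is a metric is a phantom argument: it lets the metric structure be attached
    to an alias of the bare type [T] and found again from that alias. *)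
Definition metric_of (_ : is_metric d) : Type := T.

Variable dm : is_metric d.

Let dxx x : d x x = 0. Proof. by apply/(is_metric_eq0 dm). Qed.

Let d_eq0 x y : d x y = 0 -> x = y.
Proof. by move/(is_metric_eq0 dm). Qed.

Let d_triangle y x z : d x z <= d x y + d y z.
Proof. exact: (is_metric_triangle dm). Qed.

HB.instance Definition _ := gen_eqMixin (metric_of dm).
HB.instance Definition _ := gen_choiceMixin (metric_of dm).
HB.instance Definition _ := @isMetric.Build R (metric_of dm) d
  dxx d_eq0 (is_metric_sym dm) d_triangle.

Lemma mdist_metric_of (x y : metric_of dm) : mdist x y = d x y.
Proof. by []. Qed.

End MetricOf.

Lemma filterI_ex (T : Type) (F : set_system T) {PF : ProperFilter F}
  (A B : set T) : F A -> F B -> exists x, A x /\ B x.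
Proof. by move=> FA FB; exact: filter_ex (filterI FA FB). Qed.

Lemma ultra_fmap (T U : Type) (f : T -> U) (F : set_system T) :
  UltraFilter F -> UltraFilter (f @ F).
Proof.
move=> UF; split; first exact: fmap_proper_filter.
move=> G PG FG; apply/seteqP; split => [A GA|]; last exact: FG.
have [//|FA] := in_ultra_setVsetC (f @^-1` A) UF.
have GcA : G (~` A) by exact: FG.
by have [x []] := filterI_ex GA GcA.
Qed.

Section MetricTopology.
Variables (R : realType) (M : metricType R).
Implicit Types (x y z : M) (A B K : set M).

Lemma mdist_nearP x (P : set M) :
  nbhs x P <-> exists2 e : R, 0 < e & forall y, mdist x y < e -> P y.
Proof. exact: metricType_numDomainType.nbhs_mdistP. Qed.

(** Limits along ultrafilters, expressed by distances, replace diagonal extraction of subsequences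
    wherever infinitely many points must converge at once. *)
Lemma compact_ultraP K : compact K <->
  forall F, UltraFilter F -> F K ->
    exists2 x, K x & forall e : R, 0 < e -> F [set y | mdist x y < e].
Proof.
rewrite compact_ultra /=; split=> [cK F UF FK|cK F UF FK].
  have [x [Kx Fx]] := cK F UF FK; exists x => // e e0.
  by apply: Fx; apply/mdist_nearP; exists e.
have [x Kx Fx] := cK F UF FK; exists x; split => //= A /mdist_nearP[e e0 xA].
by apply: filterS (Fx e e0).
Qed.

Lemma compact_seq K (u : nat -> M) : compact K -> (forall n, K (u n)) ->
  exists2 x, K x & forall (e : R) N, 0 < e -> exists2 n, (N <= n)%N & mdist x (u n) < e.
Proof.
move=> cK uK; have uF : (u @ \oo) K by exists 0%N => // n _; exact: uK.
have [x [Kx ux]] := cK (u @ \oo) _ uF.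
exists x => // e N e0.
have [||_ [[n /= Nn <-] ?]] :=
  ux (u @` [set n | (N <= n)%N]) [set y | mdist x y < e].
- by exists N => // n Nn; exists n.
- by apply/mdist_nearP; exists e.
- by exists n.
Qed.

Lemma closed_mdistP A : closed A <->
  forall x, (forall e : R, 0 < e -> exists2 y, A y & mdist x y < e) -> A x.
Proof.
split=> [cA x xA|cA x xA].
  apply: cA => B /mdist_nearP[e e0 xB].
  by have [y Ay /xB By] := xA _ e0; exists y.
apply: cA => e e0; have [|y [Ay xy]] := xA [set y | mdist x y < e].
  by apply/mdist_nearP; exists e.
by exists y.
Qed.

Lemma closed_mdist_le x (r : R) : closed [set y | mdist x y <= r].
Proof.
apply/closed_mdistP => y yP; apply/ler_addgt0Pr => e e0.
have [z /= xz yz] := yP e e0.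
apply: le_trans (metric_triangle _ z _) _.
by rewrite lerD// metric_sym ltW.
Qed.

(** Total boundedness with compact nets instead of finite ones. An ultrafilter on [A] is pushed to a
    net, where it has a limit; the limits [k n] for finer and finer nets form a Cauchy sequence
    because members of the ultrafilter meet, and their limit is that of the ultrafilter. *)
Lemma compact_thicken A : complete_metric (@mdist R M) -> closed A ->
  (forall e : R, 0 < e -> exists2 K, compact K & A `<=` thicken K e) ->
  compact A.
Proof.
move=> cM cA hA; apply/compact_ultraP => F UF FA.
have kP (n : nat) : exists k, F [set y | mdist k y < n.+1%:R^-1].
  have e0 : 0 < (n.+1%:R^-1 / 2 : R) by rewrite divr_gt0 ?invr_gt0.
  have [K cK AK] := hA _ e0.
  (* Off [A] the projection takes the junk value [x]; this is harmless since [A] belongs to [F]. *)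
  have piP x : exists y, A x -> K y /\ mdist x y <= n.+1%:R^-1 / 2.
    by have [/AK[y ? ?]|nAx] := pselect (A x); [exists y|exists x].
  have {piP}[pi piP] := choice piP.
  have piF : F (pi @^-1` K) by apply: filterS FA => x /piP[].
  have [k Kk kF] := (compact_ultraP K).1 cK _ (ultra_fmap pi UF) piF.
  have {}kF e : 0 < e -> F [set x | mdist k (pi x) < e] by exact: kF.
  exists k; apply: filterS (filterI FA (kF _ e0)) => x [/piP[_ xpi] /= kpi].
  apply: le_lt_trans (metric_triangle _ (pi x) _) _.
  by rewrite [ltRHS]splitr ltr_leD// metric_sym.
have [k {}kP] := choice kP.
have kk m n : mdist (k m) (k n) < m.+1%:R^-1 + n.+1%:R^-1.
  have [x [/= mx nx]] := filterI_ex (kP m) (kP n).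
  by apply: le_lt_trans (metric_triangle _ x _) _; rewrite ltrD// metric_sym.
have invlt (e : R) : 0 < e -> exists N, forall n, (N <= n)%N -> n.+1%:R^-1 < e.
  move=> e0; have := near_infty_natSinv_lt (PosNum e0).
  by case=> N _ NP; exists N => n /NP.
have [|l lP] := cM k.
  move=> e e0; have [N NP] := invlt _ (divr_gt0 e0 (ltr0Sn _ 1)).
  exists N => m n Nm Nn; apply: lt_trans (kk m n) _.
  by rewrite [ltRHS]splitr ltrD// NP.
have Fl e : 0 < e -> F [set y | mdist l y < e].
  move=> e0; have e20 : 0 < e / 2 by rewrite divr_gt0.
  have [N1 NP1] := invlt _ e20; have [N2 NP2] := lP _ e20.
  pose n := maxn N1 N2; apply: filterS (kP n) => y /= ny.
  apply: le_lt_trans (metric_triangle _ (k n) _) _.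
  rewrite [ltRHS]splitr ltrD//; last by rewrite (lt_trans ny)// NP1 ?leq_maxl.
  by rewrite metric_sym NP2 ?leq_maxr.
exists l => //; move/closed_mdistP : cA; apply=> e e0.
by have [x [Ax lx]] := filterI_ex FA (Fl _ e0); exists x.
Qed.

End MetricTopology.

(** An ultrafilter is pushed forward into [K]; its limit lies in the closed range, hence pulls
    back. *)
Lemma compact_preimage_isometry (R : realType) (M N : metricType R)
    (f : M -> N) (K : set N) : (forall x y, mdist (f x) (f y) = mdist x y) ->
  closed (range f) -> compact K -> compact (f @^-1` K).
Proof.
move=> fd cf cK; apply/compact_ultraP => F UF FK.
have [z Kz zF] := (compact_ultraP K).1 cK _ (ultra_fmap f UF) FK.
have {}zF e : 0 < e -> F [set x | mdist z (f x) < e] by exact: zF.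
have [|x _ xz] := (closed_mdistP _).1 cf z.
  by move=> e e0; have /filter_ex[x xz] := zF _ e0; exists (f x).
exists x; first by rewrite /preimage/= xz.
move=> e e0; apply: filterS (zF e e0) => y.
by rewrite /= -xz fd.
Qed.

(** * Closed subsets as bcm spaces, and factorization of embeddings *)

Section SubBcm.
Variables (R : realType) (Z : bcm R) (A : set Z).
Hypotheses (cA : closed A) (A0 : A !=set0).

Let sub_dist (x y : {z | A z}) : R := mdist (sval x) (sval y).

Let sub_dist_metric : is_metric sub_dist.
Proof.
split; rewrite /sub_dist.
- by move=> x y; exact: mdist_ge0.
- move=> [x Ax] [y Ay] /=; split=> [/mdist_positivity xy|[->]]; last exact: mdistxx.
  by subst y; congr exist; exact: Prop_irrelevance.
- by move=> x y; exact: metric_sym.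
- by move=> x y z; exact: metric_triangle.
Qed.

Let sub_nonempty : [set: metric_of sub_dist_metric] !=set0.
Proof. by have [x Ax] := A0; exists (exist _ x Ax). Qed.

Let range_sval : range (sval : {z | A z} -> Z) = A.
Proof.
by apply/seteqP; split=> [_ [[x Ax] _ <-]//|x Ax]; exists (exist _ x Ax).
Qed.

Let sub_compact_ball (x : metric_of sub_dist_metric) (r : R) :
  compact [set y | mdist x y <= r].
Proof.
apply: (@compact_preimage_isometry R (metric_of sub_dist_metric) Z sval
  [set y | mdist (sval x) y <= r]) => //.
  by have -> : range (sval : metric_of sub_dist_metric -> Z) = A.
exact: bcm_compact_ball.
Qed.

Definition sub_bcm : bcm R := Bcm sub_nonempty sub_compact_ball.

Definition sub_bcm_val : iso_emb sub_bcm Z :=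
  @IsoEmb R sub_bcm Z sval (fun _ _ => erefl).

Lemma range_sub_bcm_val : range sub_bcm_val = A.
Proof. exact: range_sval. Qed.

End SubBcm.

Lemma iso_emb_eq (R : realType) (X Y : bcm R) (f g : iso_emb X Y) :
  f =1 g -> f = g.
Proof.
move: f g => [f fd] [g gd] /= /funext fg; subst g.
by congr IsoEmb; exact: Prop_irrelevance.
Qed.

Lemma iso_emb_inj (R : realType) (X Y : bcm R) (f : iso_emb X Y) : injective f.
Proof.
move=> x y fxy; apply: mdist_positivity.
by rewrite -(iso_emb_mdist f) fxy mdistxx.
Qed.

Lemma iso_emb_factor (R : realType) (X Y Z : bcm R)
    (f : iso_emb X Z) (g : iso_emb Y Z) :
  range f `<=` range g -> exists h : iso_emb X Y, forall x, g (h x) = f x.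
Proof.
move=> fg; have hP x : exists y, g y = f x.
  by have [|y _ <-] := fg (f x); [exists x|exists y].
have [h {}hP] := choice hP.
have hd x y : mdist (h x) (h y) = mdist x y.
  by rewrite -(iso_emb_mdist g) !hP iso_emb_mdist.
by exists (IsoEmb hd).
Qed.

(** * Completion of a pseudometric *)

Record is_pseudometric (R : realType) (T : Type) (D : T -> T -> R) : Prop :=
  IsPseudometric {
    is_pseudometric_xx : forall x, D x x = 0 ;
    is_pseudometric_sym : forall x y, D x y = D y x ;
    is_pseudometric_triangle : forall x y z, D x z <= D x y + D y z }.

(* The functions [dist(z, _)] with [z] in the completion of [(T, D)]: this
   model quotients and completes at once, without leaving the universe of
   [T]. *)
Record katetov (R : realType) (T : Type) (D : T -> T -> R) := Katetov {
  katetov_fun :> T -> R ;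
  katetov_lip : forall s t, katetov_fun s <= katetov_fun t + D s t ;
  katetov_ge : forall s t, D s t <= katetov_fun s + katetov_fun t ;
  katetov_small : forall e : R, 0 < e -> exists t, katetov_fun t < e }.

Section KatetovSpace.
Variables (R : realType) (T : Type) (D : T -> T -> R).
Hypothesis PD : is_pseudometric D.
Local Notation kat := (katetov D).
Implicit Types (phi psi : kat) (s t : T).

Lemma katetov_eq phi psi : phi =1 psi -> phi = psi.
Proof.
case: phi psi => [f ? ? ?] [g ? ? ?] /= /funext fg; subst g.
by congr Katetov; exact: Prop_irrelevance.
Qed.

Lemma katetov_ge0 phi t : 0 <= phi t.
Proof.
have := katetov_ge phi t t; rewrite (is_pseudometric_xx PD) => ?; lra.
Qed.

(** If [phi] and [psi] are the distance functions from z and w, then [phi t + psi t] is at least the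
    distance from z to w, and nearly equal to it when [t] is close to z. *)
Definition katetov_dist phi psi : R := inf (range (fun t => phi t + psi t)).

Lemma katetov_dist_le phi psi t : katetov_dist phi psi <= phi t + psi t.
Proof.
apply: ge_inf; last by exists t.
by exists 0 => _ [s _ <-]; rewrite addr_ge0 ?katetov_ge0.
Qed.

Lemma katetov_dist_ge phi psi (c : R) :
  (forall t, c <= phi t + psi t) -> c <= katetov_dist phi psi.
Proof.
move=> cP; apply: lb_le_inf; last by move=> _ [t _ <-].
by have [t _] := katetov_small phi ltr01; exists (phi t + psi t), t.
Qed.

(** For every s, [phi t] is at most [phi s + D t s], hence at most [phi s + psi s + psi t]. The sup
    distance is therefore dominated by [katetov_dist]; separation, the triangle inequality and
    completeness all rest on this. *)
Lemma katetov_lip_dist phi psi t : phi t <= psi t + katetov_dist phi psi.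
Proof.
rewrite -lerBlDl; apply: katetov_dist_ge => s.
have := katetov_lip phi t s; have := katetov_ge psi t s => ? ?; lra.
Qed.

Lemma katetov_dist_sym phi psi : katetov_dist phi psi = katetov_dist psi phi.
Proof. by rewrite /katetov_dist; under eq_fun do rewrite addrC. Qed.

Lemma katetov_dist_metric : is_metric katetov_dist.
Proof.
split.
- by move=> phi psi; apply: katetov_dist_ge => t; rewrite addr_ge0 ?katetov_ge0.
- move=> phi psi; split=> [d0|->].
    apply: katetov_eq => t; apply/eqP; rewrite eq_le.
    have := katetov_lip_dist phi psi t; have := katetov_lip_dist psi phi t.
    by rewrite katetov_dist_sym d0 !addr0 => -> ->.
  apply/eqP; rewrite eq_le; apply/andP; split.
    apply/ler_addgt0Pr => e e0.
    have [t te] := katetov_small psi (divr_gt0 e0 (ltr0Sn R 1)).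
    by have := katetov_dist_le psi psi t => ?; lra.
  by apply: katetov_dist_ge => t; rewrite addr_ge0 ?katetov_ge0.
- exact: katetov_dist_sym.
- move=> phi psi chi; rewrite -lerBlDr; apply: katetov_dist_ge => t.
  have := katetov_dist_le phi chi t; have := katetov_lip_dist chi psi t.
  rewrite (katetov_dist_sym chi) => ? ?; lra.
Qed.

Let katetov_point_lip t s s' : D t s <= D t s' + D s s'.
Proof.
by have := is_pseudometric_triangle PD t s' s; rewrite (is_pseudometric_sym PD s s').
Qed.

Let katetov_point_ge t s s' : D s s' <= D t s + D t s'.
Proof.
by have := is_pseudometric_triangle PD s t s'; rewrite (is_pseudometric_sym PD s t).
Qed.

Let katetov_point_small t (e : R) : 0 < e -> exists s, D t s < e.
Proof. by move=> e0; exists t; rewrite (is_pseudometric_xx PD). Qed.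

Definition katetov_point t : kat :=
  Katetov (katetov_point_lip t) (katetov_point_ge t) (@katetov_point_small t).

Lemma katetov_dist_point t phi : katetov_dist (katetov_point t) phi = phi t.
Proof.
apply/eqP; rewrite eq_le; apply/andP; split.
  have := katetov_dist_le (katetov_point t) phi t.
  by rewrite /= (is_pseudometric_xx PD) add0r.
apply: katetov_dist_ge => s /=; rewrite addrC; exact: katetov_lip.
Qed.

(** A Cauchy sequence converges uniformly on [T], and the three defining conditions pass to the
    uniform limit. Convergence in [katetov_dist] is then tested at a single point where [u n] is
    small. *)
Lemma katetov_complete : complete_metric katetov_dist.
Proof.
move=> u uC.
have uCt t (e : R) : 0 < e ->
    exists N, forall m n, (N <= m)%N -> (N <= n)%N -> `|u m t - u n t| < e.
  move=> e0; have [N NP] := uC e e0; exists N => m n Nm Nn.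
  have := NP m n Nm Nn => d1; have := NP n m Nn Nm => d2.
  have := katetov_lip_dist (u m) (u n) t; have := katetov_lip_dist (u n) (u m) t.
  by rewrite ltr_distl => ? ?; apply/andP; split; lra.
have fP t : exists l : R, (fun n => u n t) @ \oo --> l.
  apply/cvg_ex/cauchy_cvgP/cauchy_exP => e e0.
  have [N NP] := uCt t e e0; exists (u N t).
  by exists N => // n Nn; rewrite -ball_normE /=; apply: NP.
have [f {}fP] := choice fP.
have fN (e : R) : 0 < e ->
    exists N, forall n, (N <= n)%N -> forall t, f t <= u n t + e /\ u n t <= f t + e.
  move=> e0; have [N NP] := uC e e0; exists N => n Nn t; split.
    apply: (cvgr_to_le (fP t)).
    exists N => // m Nm /=; apply: le_trans (katetov_lip_dist _ (u n) _) _.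
    by rewrite lerD2l ltW// NP.
  rewrite -lerBlDr.
  apply: (cvgr_to_ge (fP t)).
  exists N => // m Nm /=; rewrite lerBlDr.
  apply: le_trans (katetov_lip_dist _ (u m) _) _.
  by rewrite lerD2l ltW// NP.
have f_lip s t : f s <= f t + D s t.
  apply/ler_addgt0Pr => e e0; have [N NP] := fN _ (divr_gt0 e0 (ltr0Sn R 1)).
  have [? _] := NP N (leqnn N) s; have [_ ?] := NP N (leqnn N) t.
  have := katetov_lip (u N) s t => ?; lra.
have f_ge s t : D s t <= f s + f t.
  apply/ler_addgt0Pr => e e0; have [N NP] := fN _ (divr_gt0 e0 (ltr0Sn R 1)).
  have [_ ?] := NP N (leqnn N) s; have [_ ?] := NP N (leqnn N) t.
  have := katetov_ge (u N) s t => ?; lra.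
have f_small (e : R) : 0 < e -> exists t, f t < e.
  move=> e0; have [N NP] := fN _ (divr_gt0 e0 (ltr0Sn R 1)).
  have [t te] := katetov_small (u N) (divr_gt0 e0 (ltr0Sn R 1)); exists t.
  have [? _] := NP N (leqnn N) t; lra.
exists (Katetov f_lip f_ge f_small) => e e0.
have e40 : 0 < e / 4 by rewrite divr_gt0.
have [N NP] := fN _ e40; exists N => n Nn.
have [t te] := katetov_small (u n) e40; have [? _] := NP n Nn t.
by have := katetov_dist_le (u n) (Katetov f_lip f_ge f_small) t => /= ?; lra.
Qed.

Definition katetov_space := metric_of katetov_dist_metric.

Lemma katetov_point_mdist s t :
  mdist (katetov_point s : katetov_space) (katetov_point t) = D s t.
Proof. by rewrite mdist_metric_of katetov_dist_point /= (is_pseudometric_sym PD). Qed.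

Section Bcm.
Variable t0 : T.
Hypothesis nets : forall r e : R, 0 < e -> exists2 K : set katetov_space,
  compact K & forall t, D t0 t <= r -> exists2 phi, K phi & phi t <= e.

Let katetov_nonempty : [set: katetov_space] !=set0.
Proof. by exists (katetov_point t0). Qed.

(** Since [phi t] is the distance from [phi] to the point [t], [nets] provides compact nets for the
    balls of [T] only. An element of a ball of the completion is first moved by less than [e / 2] to
    a point of [T], then by at most [e / 2] into the net. *)
Let katetov_compact_ball (phi : katetov_space) (r : R) :
  compact [set psi | mdist phi psi <= r].
Proof.
apply: compact_thicken; [exact: katetov_complete|exact: closed_mdist_le|].
move=> e e0; have e20 : 0 < e / 2 by rewrite divr_gt0.
have [K cK KP] := nets (phi t0 + r + e) e20.
exists K => // psi /= phipsi; have [t te] := katetov_small psi e20.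
have [|chi Kchi chit] := KP t.
  have := katetov_ge psi t0 t; have := katetov_lip_dist psi phi t0.
  rewrite katetov_dist_sym; rewrite mdist_metric_of in phipsi => ? ?; lra.
exists chi => //; rewrite mdist_metric_of.
by have := katetov_dist_le psi chi t => ?; lra.
Qed.

Definition katetov_bcm : bcm R := Bcm katetov_nonempty katetov_compact_ball.

End Bcm.
End KatetovSpace.

(** * Chain distance on a sequence of coupled spaces *)

(** The cross distances of a pseudometric on the disjoint union of [X] and [Y] that extends both
    metrics and identifies the two roots. *)
Record is_coupling (R : realType) (X Y : bcm R) (x0 : X) (y0 : Y)
    (delta : X -> Y -> R) : Prop := IsCoupling {
  coupling_root : delta x0 y0 = 0 ;
  coupling_lipl : forall x x' y, delta x y <= mdist x x' + delta x' y ;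
  coupling_lipr : forall x y y', delta x y <= delta x y' + mdist y' y ;
  coupling_gel : forall x x' y, mdist x x' <= delta x y + delta x' y ;
  coupling_ger : forall x y y', mdist y y' <= delta x y + delta x y' }.

Lemma seq_argmax (T : Type) (f : T -> nat) (l : seq T) : l <> [::] ->
  exists l1 b l2, l = l1 ++ b :: l2 /\ all (fun x => f x <= f b)%N l.
Proof.
elim: l => // a [|c l] IH _; first by exists [::], a, [::]; rewrite /= leqnn.
have [//|l1 [b [l2 [ll lb]]]] := IH.
have [ab|ba] := leqP (f a) (f b).
  by exists (a :: l1), b, l2; rewrite ll /= ab -ll.
exists [::], a, (c :: l); split=> //; rewrite [all _ _]/= leqnn /=.
by apply: sub_all lb => x xb; rewrite (leq_trans xb)// ltnW.
Qed.

Lemma seq_argmin (T : Type) (f : T -> nat) (l : seq T) : l <> [::] ->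
  exists l1 b l2, l = l1 ++ b :: l2 /\ all (fun x => f b <= f x)%N l.
Proof.
elim: l => // a [|c l] IH _; first by exists [::], a, [::]; rewrite /= leqnn.
have [//|l1 [b [l2 [ll lb]]]] := IH.
have [ab|ba] := leqP (f b) (f a).
  by exists (a :: l1), b, l2; rewrite ll /= ab -ll.
exists [::], a, (c :: l); split=> //; rewrite [all _ _]/= leqnn /=.
by apply: sub_all lb => x xb; rewrite (leq_trans _ xb)// ltnW.
Qed.

Section ChainDistance.
Variables (R : realType) (X : nat -> bcm R) (rho : forall n, X n).
Variable delta : forall n, X n -> X n.+1 -> R.
Hypothesis cdelta : forall n, is_coupling (rho n) (rho n.+1) (@delta n).

Local Notation T := {n & X n}.
Local Notation pt n x := (existT (fun k : nat => bcm_metric (X k)) n x).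
Implicit Types (s t a b c : T) (l : seq T).

Definition root_dist s : R := mdist (rho (projT1 s)) (projT2 s).

(** Distances are prescribed only on one level or between adjacent levels; elsewhere the edge is the
    route through the roots, which are to be identified. Levels are compared with proofs of equality
    so that a vertex can be transported to the type expected by [mdist] or [delta]. *)
Definition edge s t : R :=
  let: existT n x := s in let: existT m y := t in
  match n =P m, n.+1 =P m, m.+1 =P n with
  | ReflectT e, _, _ => mdist (eq_rect n (fun k => X k : Type) x m e) y
  | _, ReflectT e, _ => delta x (eq_rect m (fun k => X k : Type) y n.+1 (esym e))
  | _, _, ReflectT e => delta y (eq_rect n (fun k => X k : Type) x m.+1 (esym e))
  | _, _, _ => root_dist s + root_dist t
  end.

#[local] Arguments edge : simpl never.

Lemma edge_same n (x y : X n) : edge (pt n x) (pt n y) = mdist x y.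
Proof. by rewrite /edge; case: eqP => // e; rewrite (eq_irrelevance e erefl). Qed.

Lemma edge_up n (x : X n) (y : X n.+1) : edge (pt n x) (pt n.+1 y) = delta x y.
Proof.
rewrite /edge; case: eqP => [e|_]; first by exfalso; lia.
by case: eqP => // e; rewrite (eq_irrelevance (esym e) erefl).
Qed.

Lemma edge_down n (x : X n) (y : X n.+1) : edge (pt n.+1 y) (pt n x) = delta x y.
Proof.
rewrite /edge; case: eqP => [e|_]; first by exfalso; lia.
case: eqP => [e|_]; first by exfalso; lia.
by case: eqP => // e; rewrite (eq_irrelevance (esym e) erefl).
Qed.

Lemma edge_far s t :
  ((projT1 s).+1 < projT1 t)%N || ((projT1 t).+1 < projT1 s)%N ->
  edge s t = root_dist s + root_dist t.
Proof.
case: s t => [n x] [m y] /= nm; rewrite /edge.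
case: eqP => [e|_]; first by exfalso; lia.
case: eqP => [e|_]; first by exfalso; lia.
by case: eqP => [e|_]; first by exfalso; lia.
Qed.

(** A case analysis that hides the transports in [edge]. *)
Variant edge_cases : T -> T -> Type :=
| EdgeSame n (x y : X n) : edge_cases (pt n x) (pt n y)
| EdgeUp n (x : X n) (y : X n.+1) : edge_cases (pt n x) (pt n.+1 y)
| EdgeDown n (x : X n) (y : X n.+1) : edge_cases (pt n.+1 y) (pt n x)
| EdgeFar s t : ((projT1 s).+1 < projT1 t)%N || ((projT1 t).+1 < projT1 s)%N ->
    edge_cases s t.

Lemma edgeP s t : edge_cases s t.
Proof.
case: s t => [n x] [m y].
have [e|nm] := eqVneq n m; first by subst m; exact: EdgeSame.
have [e|nm1] := eqVneq n.+1 m; first by subst m; exact: EdgeUp.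
have [e|mn1] := eqVneq m.+1 n; first by subst n; exact: EdgeDown.
by apply: EdgeFar => /=; lia.
Qed.

Lemma edge_sym s t : edge s t = edge t s.
Proof.
case: (edgeP s t) => [n x y|n x y|n x y|{}s {}t st].
- by rewrite !edge_same metric_sym.
- by rewrite edge_up edge_down.
- by rewrite edge_up edge_down.
- by rewrite (edge_far st) edge_far 1?orbC // addrC.
Qed.

Lemma root_dist_ge0 s : 0 <= root_dist s.
Proof. exact: mdist_ge0. Qed.

Lemma edge_ge0 s t : 0 <= edge s t.
Proof.
have delta_ge0 n x y : 0 <= @delta n x y.
  by have := coupling_gel (cdelta n) x x y; rewrite mdistxx => ?; lra.
case: (edgeP s t) => [n x y|n x y|n x y|{}s {}t st].
- by rewrite edge_same mdist_ge0.
- by rewrite edge_up.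
- by rewrite edge_down.
- by rewrite edge_far // addr_ge0 // root_dist_ge0.
Qed.

Lemma edge_le s t : edge s t <= root_dist s + root_dist t.
Proof.
have H n x y : @delta n x y <= root_dist (pt n x) + root_dist (pt n.+1 y).
  have := coupling_lipl (cdelta n) x (rho n) y.
  have := coupling_lipr (cdelta n) (rho n) y (rho n.+1).
  rewrite (coupling_root (cdelta n)) /root_dist /= (metric_sym x) => ? ?; lra.
case: (edgeP s t) => [n x y|n x y|n x y|{}s {}t st].
- rewrite edge_same /root_dist /= (metric_sym (rho n) x); exact: metric_triangle.
- by rewrite edge_up.
- by rewrite edge_down addrC.
- by rewrite edge_far.
Qed.

Lemma root_dist_lip s t : root_dist s <= root_dist t + edge s t.
Proof.
have H n x y : root_dist (pt n x) <= root_dist (pt n.+1 y) + @delta n x y.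
  have := coupling_gel (cdelta n) (rho n) x (rho n.+1).
  have := coupling_lipr (cdelta n) x (rho n.+1) y.
  rewrite (coupling_root (cdelta n)) /root_dist /= (metric_sym y) => ? ?; lra.
have H' n x y : root_dist (pt n.+1 y) <= root_dist (pt n x) + @delta n x y.
  have := coupling_ger (cdelta n) (rho n) (rho n.+1) y.
  have := coupling_lipl (cdelta n) (rho n) x y.
  rewrite (coupling_root (cdelta n)) /root_dist /= => ? ?; lra.
case: (edgeP s t) => [n x y|n x y|n x y|{}s {}t st].
- by rewrite edge_same /root_dist /= (metric_sym x) metric_triangle.
- by rewrite edge_up.
- by rewrite edge_down.
- rewrite edge_far //; have := root_dist_ge0 t => ?; lra.
Qed.

(** The edge from [a] to [b] already runs through the roots, so the rest reduces to comparing the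
    root distances of [b] and [c]. *)
Let edge_triangle_far a b c :
  ((projT1 a).+1 < projT1 b)%N || ((projT1 b).+1 < projT1 a)%N ->
  edge a c <= edge a b + edge b c.
Proof.
move=> ab; rewrite (edge_far ab).
have := edge_le a c; have := root_dist_lip c b; rewrite (edge_sym c) => ? ?; lra.
Qed.

(** Unless a far edge occurs, [a] and [c] lie on the level of [b] or just below, and each case is
    the triangle inequality of one level or a coupling axiom. The condition on levels matters:
    climbing two levels through [b] may be shorter than the direct edge, which goes through the
    roots. *)
Lemma edge_peak a b c : (projT1 a <= projT1 b)%N -> (projT1 c <= projT1 b)%N ->
  edge a c <= edge a b + edge b c.
Proof.
have far s u : ((projT1 s).+1 < projT1 b)%N -> edge s u <= edge s b + edge b u.
  by move=> sb; apply: edge_triangle_far; rewrite sb.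
move=> ab cb; have [/far//|ab1] := ltnP (projT1 a).+1 (projT1 b).
have [/(far c a)|cb1] := ltnP (projT1 c).+1 (projT1 b).
  by rewrite addrC (edge_sym c a) (edge_sym b a) (edge_sym c b).
case: a b c ab cb ab1 cb1 {far} => [n x] [m y] [k z] /= nm km nm1 km1.
have [e|/eqP nm2] := eqVneq n m; have [e'|/eqP km2] := eqVneq k m.
- subst n k; rewrite !edge_same; exact: metric_triangle.
- have e'' : m = k.+1 by lia.
  subst n m; rewrite edge_same !edge_down addrC metric_sym.
  exact: coupling_lipr.
- have e'' : m = n.+1 by lia.
  subst k m; rewrite edge_same !edge_up; exact: coupling_lipr.
- have e : m = n.+1 by lia.
  have e' : k = n by lia.
  subst m k; rewrite edge_same edge_up edge_down; exact: coupling_gel.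
Qed.

Lemma edge_valley a b c : (projT1 b <= projT1 a)%N -> (projT1 b <= projT1 c)%N ->
  edge a c <= edge a b + edge b c.
Proof.
have far s u : ((projT1 b).+1 < projT1 s)%N -> edge s u <= edge s b + edge b u.
  by move=> sb; apply: edge_triangle_far; rewrite sb orbT.
move=> ab cb; have [/far//|ab1] := ltnP (projT1 b).+1 (projT1 a).
have [/(far c a)|cb1] := ltnP (projT1 b).+1 (projT1 c).
  by rewrite addrC (edge_sym c a) (edge_sym b a) (edge_sym c b).
case: a b c ab cb ab1 cb1 {far} => [n x] [m y] [k z] /= nm km nm1 km1.
have [e|/eqP nm2] := eqVneq n m; have [e'|/eqP km2] := eqVneq k m.
- subst n k; rewrite !edge_same; exact: metric_triangle.
- have e'' : k = m.+1 by lia.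
  subst n k; rewrite edge_same !edge_up; exact: coupling_lipl.
- have e'' : n = m.+1 by lia.
  subst k n; rewrite edge_same !edge_down addrC metric_sym; exact: coupling_lipl.
- have e : n = m.+1 by lia.
  have e' : k = m.+1 by lia.
  subst n k; rewrite edge_same edge_up edge_down; exact: coupling_ger.
Qed.

Fixpoint chain_length s l t : R :=
  if l is b :: l' then edge s b + chain_length b l' t else edge s t.

Lemma chain_length_ge0 s l t : 0 <= chain_length s l t.
Proof. by elim: l s => [|b l IH] s /=; rewrite ?addr_ge0 ?edge_ge0. Qed.

Lemma chain_length_cat s l1 b l2 t :
  chain_length s (l1 ++ b :: l2) t = chain_length s l1 b + chain_length b l2 t.
Proof. by elim: l1 s => [|c l IH] s //=; rewrite IH addrA. Qed.

Lemma chain_length_rev s l t : chain_length s l t = chain_length t (rev l) s.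
Proof.
elim: l s => [|b l IH] s /=; first exact: edge_sym.
by rewrite rev_cons -cats1 chain_length_cat /= IH addrC edge_sym.
Qed.

Lemma chain_length_remove (P : pred T) s l1 b l2 t :
  (forall a c, P a -> P c -> edge a c <= edge a b + edge b c) ->
  P s -> P t -> all P (l1 ++ b :: l2) ->
  chain_length s (l1 ++ l2) t <= chain_length s (l1 ++ b :: l2) t.
Proof.
move=> bP; elim: l1 s => [|a l1 IH] s Ps Pt /=.
  case: l2 => [|c l2] /=; first by move=> _; exact: bP.
  by move=> /and3P[_ Pc _]; rewrite addrA lerD2r; exact: bP.
by move=> /andP[Pa Pl]; rewrite lerD2l; exact: IH.
Qed.

(* An interior vertex of extremal level, lying above or below both endpoints,
   can be removed from a chain without lengthening it. *)
Lemma chain_length_ge s l t :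
  (projT1 s <= (projT1 t).+1)%N -> (projT1 t <= (projT1 s).+1)%N ->
  edge s t <= chain_length s l t.
Proof.
move=> st ts; have [n] := ubnP (size l); elim: n l => // n IH l ln.
have [/size0nil->//|l0] := eqVneq (size l) 0%N.
have {}l0 : l <> [::] by move=> e; rewrite e in l0.
have step l1 b l2 (P : pred T) : l = l1 ++ b :: l2 ->
    (forall a c, P a -> P c -> edge a c <= edge a b + edge b c) ->
    P s -> P t -> all P l -> edge s t <= chain_length s l t.
  move=> ll bP Ps Pt Pl.
  apply: (@le_trans _ _ (chain_length s (l1 ++ l2) t)).
    by apply: IH; move: ln; rewrite ll !size_cat /=; lia.
  by rewrite ll in Pl *; exact: (chain_length_remove bP).
have [l1 [b [l2 [ll lb]]]] := seq_argmax (@projT1 nat (fun k => X k)) l0.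
(* If the highest vertex is not above both endpoints, every vertex is strictly below one of them;
   the levels of the endpoints differ by at most one, so the lowest vertex is below both. *)
have [sb|sb] := leqP (projT1 s) (projT1 b);
  have [tb|tb] := leqP (projT1 t) (projT1 b).
  by apply: step ll _ sb tb lb => a c; exact: edge_peak.
all: have [l1' [b' [l2' [ll' lb']]]] := seq_argmin (@projT1 nat (fun k => X k)) l0.
all: have b'b : (projT1 b' <= projT1 b)%N
  by move: lb'; rewrite ll all_cat /= => /and3P[].
all: apply: (step _ _ _ (fun x => projT1 b' <= projT1 x)%N ll' _ _ _ lb'); [
  by move=> a c; exact: edge_valley | lia | lia].
Qed.

Definition chain_dist s t : R := inf (range (fun l => chain_length s l t)).

Lemma chain_dist_le s l t : chain_dist s t <= chain_length s l t.
Proof.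
apply: ge_inf; last by exists l.
by exists 0 => _ [l' _ <-]; exact: chain_length_ge0.
Qed.

Lemma chain_dist_ge s t (r : R) :
  (forall l, r <= chain_length s l t) -> r <= chain_dist s t.
Proof.
move=> h; apply: lb_le_inf; first by exists (chain_length s [::] t), [::].
by move=> _ [l _ <-].
Qed.

Lemma chain_distE s t :
  (projT1 s <= (projT1 t).+1)%N -> (projT1 t <= (projT1 s).+1)%N ->
  chain_dist s t = edge s t.
Proof.
move=> st ts; apply/eqP; rewrite eq_le (chain_dist_le s [::] t) /=.
by apply: chain_dist_ge => l; exact: chain_length_ge.
Qed.

Lemma chain_dist_pseudometric : is_pseudometric chain_dist.
Proof.
split.
- by move=> [n x]; rewrite chain_distE // edge_same mdistxx.
- move=> s t; rewrite /chain_dist; congr inf; apply/seteqP; split => _ [l _ <-];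
  by exists (rev l) => //; rewrite chain_length_rev revK.
- move=> a b c; rewrite -lerBlDr; apply: chain_dist_ge => l.
  rewrite lerBlDr -lerBlDl; apply: chain_dist_ge => l'; rewrite lerBlDl.
  by rewrite -chain_length_cat; exact: chain_dist_le.
Qed.

End ChainDistance.

Arguments edge : simpl never.

(** * Gluing *)

Lemma exp2N_small (R : realType) (e : R) : 0 < e ->
  exists N, forall n, (N <= n)%N -> 2 ^- n < e.
Proof.
move=> e0; have [N _ NP] := near_infty_natSinv_lt (PosNum e0).
exists N => n Nn; apply: le_lt_trans (NP _ Nn).
by rewrite lef_pV2 ?posrE ?exprn_gt0// -natrX ler_nat ltn_expl.
Qed.

Lemma isometry_continuous (R : realType) (M N : metricType R) (f : M -> N) :
  (forall x y, mdist (f x) (f y) = mdist x y) -> continuous f.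
Proof.
move=> fd x; apply/metricType_numDomainType.cvgrPdist_lt => e e0.
by apply/mdist_nearP; exists e => // y; rewrite fd.
Qed.

(* Fell convergence in quantitative form: [e]-inclusions on each ball about the
   root, the target set not being truncated. *)
Definition loc_cauchy (R : realType) (Z : bcm R) (z0 : Z) (A : nat -> set Z) :=
  forall r e : R, 0 < e -> exists N, forall n m, (N <= n)%N -> (N <= m)%N ->
    A n `&` cball z0 r `<=` thicken (A m) e.

Section Gluing.
Variables (R : realType) (X : nat -> bcm R) (rho : forall n, X n).
Variable delta : forall n, X n -> X n.+1 -> R.
Hypothesis cdelta : forall n, is_coupling (rho n) (rho n.+1) (@delta n).
Hypothesis delta_small : forall r : R, exists N, forall n, (N <= n)%N ->
  (forall x, mdist (rho n) x <= r -> exists y, @delta n x y <= 2 ^- n) /\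
  (forall y, mdist (rho n.+1) y <= r -> exists x, @delta n x y <= 2 ^- n).

Local Notation T := {n & X n}.
Local Notation pt n x := (existT (fun k : nat => bcm_metric (X k)) n x).
Local Notation D := (chain_dist rho delta).
Local Notation nrm := (root_dist rho).
Let PD : is_pseudometric D := chain_dist_pseudometric cdelta.
Implicit Types s t : T.

(** [root_dist_lip] is summed along a chain. This keeps points obtained by short chains in a
    controlled ball about the roots. *)
Lemma root_dist_chain s t : nrm t <= nrm s + D s t.
Proof.
rewrite -lerBlDl; apply: chain_dist_ge => l; rewrite lerBlDl.
elim: l s => [|b l IH] s /=; last first.
  have := IH b; have := root_dist_lip cdelta b s.
  rewrite (edge_sym rho delta) => ? ?; lra.
by have := root_dist_lip cdelta t s; rewrite (edge_sym rho delta).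
Qed.

Let D_up n (x : X n) (y : X n.+1) : D (pt n x) (pt n.+1 y) = delta x y.
Proof. by rewrite (chain_distE cdelta) ?edge_up //=; lia. Qed.

Let D_same n (x y : X n) : D (pt n x) (pt n y) = mdist x y.
Proof. by rewrite (chain_distE cdelta) ?edge_same. Qed.

Let exp2NS k : 2 ^- k = 2 * 2 ^- k.+1 :> R.
Proof. by rewrite exprS invfM mulrA mulfV ?mul1r. Qed.

Let exp2N_gt0 k : 0 < 2 ^- k :> R.
Proof. by rewrite invr_gt0 exprn_gt0. Qed.

(** The bound is the sum of [2 ^- j] for j from n to k + n - 1. The distance to the root grows by
    less than [2 * 2 ^- n] in all, so the matching hypothesis on radius [r] applies at every
    level. *)
Let chain_climb (r : R) (n : nat) :
  (forall k, (n <= k)%N -> forall x, mdist (rho k) x <= r ->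
    exists y, @delta k x y <= 2 ^- k) ->
  forall k (x : X n), nrm (pt n x) + 2 * 2 ^- n <= r -> exists y : X (k + n)%N,
    D (pt n x) (pt (k + n)%N y) <= 2 * 2 ^- n - 2 * 2 ^- (k + n).
Proof.
move=> h k x xr; elim: k => [|k [y yP]].
  by exists x; rewrite D_same mdistxx subrr.
have pk := exp2N_gt0 (k + n).
have [||y' y'P] := h (k + n)%N _ y; first by lia.
  have := root_dist_chain (pt n x) (pt (k + n)%N y).
  by rewrite {1}/root_dist /= => ?; lra.
exists y'; have := is_pseudometric_triangle PD (pt n x) (pt _ y) (pt _ y').
rewrite D_up => ?; have := exp2NS (k + n); change (k.+1 + n)%N with (k + n).+1 => ?; lra.
Qed.

(** Going down, the slack required in the hypothesis is the part of the geometric sum still to be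
    spent; it decreases by exactly the amount by which one step may move the point. *)
Let chain_descend (r : R) (n : nat) :
  (forall k, (n <= k)%N -> forall y, mdist (rho k.+1) y <= r ->
    exists x, @delta k x y <= 2 ^- k) ->
  forall k (y : X (k + n)%N),
    nrm (pt _ y) + (2 * 2 ^- n - 2 * 2 ^- (k + n)) <= r -> exists x : X n,
    D (pt n x) (pt (k + n)%N y) <= 2 * 2 ^- n - 2 * 2 ^- (k + n).
Proof.
move=> h; elim=> [|k IH] y yr.
  by exists y; rewrite D_same mdistxx subrr.
have pk := exp2N_gt0 (k + n); have pkS := exp2NS (k + n).
have pn : 2 ^- (k + n) <= 2 ^- n :> R.
  by rewrite lef_pV2 ?posrE ?exprn_gt0// ler_eXn2l ?ltr1n//; lia.
rewrite addSn in y yr *.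
have [||y' y'P] := h (k + n)%N _ y; first by lia.
  by move: yr; rewrite {1}/root_dist /= => ?; lra.
have y'n := root_dist_chain (pt _ y) (pt _ y').
rewrite (is_pseudometric_sym PD) D_up in y'n.
have [|x xP] := IH y'; first by lra.
exists x; have := is_pseudometric_triangle PD (pt n x) (pt _ y') (pt _ y).
rewrite D_up => ?; lra.
Qed.

Lemma chain_loc_cauchy (r e : R) : 0 < e -> exists N, forall n m,
  (N <= n)%N -> (N <= m)%N -> forall x : X n, mdist (rho n) x <= r ->
  exists y : X m, D (pt n x) (pt m y) <= e.
Proof.
(* The total drift along the levels from n on is at most [2 * 2 ^- n], hence at most 2. *)
move=> e0; have [N1 NP1] := delta_small (r + 2).
have [N2 NP2] := exp2N_small (divr_gt0 e0 (ltr0Sn R 1)).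
exists (maxn N1 N2) => n m; rewrite !geq_max => /andP[n1 n2] /andP[m1 m2] x xr.
have le1 k : 2 ^- k <= 1 :> R by rewrite invf_le1 ?exprn_gt0// exprn_ege1// ler1n.
have [nm|/ltnW mn] := leqP n m.
  have [||y yP] := @chain_climb (r + 2) n _ (m - n)%N x.
  - by move=> k nk z; have [+ _] := NP1 k (leq_trans n1 nk); exact.
  - by rewrite /root_dist /=; have := le1 n => ?; lra.
  rewrite -(subnK nm); exists y; apply: le_trans yP _.
  by have := NP2 _ n2; have := exp2N_gt0 (m - n + n) => ? ?; lra.
move: x xr; rewrite -{1 2 3 4}(subnK mn) => x xr.
have [||y yP] := @chain_descend (r + 2) m _ (n - m)%N x.
- by move=> k nk z; have [_] := NP1 k (leq_trans m1 nk); exact.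
- rewrite /root_dist /=; have := le1 m; have := exp2N_gt0 (n - m + m) => ? ?; lra.
exists y; rewrite (is_pseudometric_sym PD); apply: le_trans yP _.
by have := NP2 _ m2; have := exp2N_gt0 (n - m + m) => ? ?; lra.
Qed.

Let layer n (x : X n) : katetov_space PD := katetov_point PD (pt n x).

Let layer_mdist n (x y : X n) : mdist (layer x) (layer y) = mdist x y.
Proof. by rewrite katetov_point_mdist D_same. Qed.

(** Beyond some level [N] every point of the ball is within [e] of layer [N], so finitely many
    compact balls, enlarged by [e], form a net. *)
Let layer_nets (r e : R) : 0 < e -> exists2 K : set (katetov_space PD),
  compact K & forall t, D (pt 0%N (rho 0%N)) t <= r ->
                exists2 phi, K phi & phi t <= e.
Proof.
move=> e0; have [N NP] := chain_loc_cauchy r e0.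
pose K n := @layer n @` cball (rho n) (r + e).
exists (\big[setU/set0]_(n <- iota 0 N.+1) K n).
  apply: bigsetU_compact => n _; apply: continuous_compact; last first.
    exact: bcm_compact_ball.
  by apply/continuous_subspaceT/isometry_continuous => x y; exact: layer_mdist.
have KN n phi : (n <= N)%N -> K n phi -> (\big[setU/set0]_(i <- iota 0 N.+1) K i) phi.
  move=> nN Kphi; rewrite -bigcup_seq; exists n => //=.
  by rewrite -[_ :: _]/(iota 0 N.+1) mem_iota add0n ltnS.
move=> [m x] xr.
have {}xr : mdist (rho m) x <= r.
  apply: le_trans xr; have := root_dist_chain (pt 0%N (rho 0%N)) (pt m x).
  by rewrite /root_dist /= mdistxx add0r.
have [mN|/ltnW Nm] := leqP m N.
  exists (layer x); last by rewrite /= D_same mdistxx ltW.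
  by apply: (KN m) => //; exists x => //=; rewrite /cball /=; lra.
have [y yP] := NP m N Nm (leqnn N) x xr.
exists (layer y); last by rewrite /= (is_pseudometric_sym PD).
apply: (KN N) => //; exists y => //=; rewrite /cball /=.
by have := root_dist_chain (pt m x) (pt N y); rewrite /root_dist /= => ?; lra.
Qed.

Theorem gluing : exists (Z : bcm R) (z0 : Z) (f : forall n, iso_emb (X n) Z),
  [/\ forall n, f n (rho n) = z0,
      forall n x y, mdist (f n x) (f n.+1 y) = delta x y &
      loc_cauchy z0 (fun n => range (f n))].
Proof.
pose Z := katetov_bcm layer_nets.
pose f n : iso_emb (X n) Z := @IsoEmb R (X n) Z (@layer n) (@layer_mdist n).
(* All roots are glued together: by [edge_le] the edge between two roots has length zero, whatever
   their levels. *)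
have froot n : f n (rho n) = f 0%N (rho 0%N).
  apply: mdist_positivity; apply/eqP; rewrite eq_le mdist_ge0 andbT.
  rewrite [mdist _ _]katetov_point_mdist.
  apply: le_trans (chain_dist_le cdelta _ [::] _) _ => /=.
  by apply: le_trans (edge_le cdelta _ _) _; rewrite /root_dist /= !mdistxx addr0.
exists Z, (f 0%N (rho 0%N)), f; split=> //.
  by move=> n x y; rewrite [mdist _ _]katetov_point_mdist D_up.
move=> r e e0; have [N NP] := chain_loc_cauchy r e0.
exists N => n m Nn Nm _ [[x _ <-]]; rewrite -(froot n) /cball /= [mdist _ _]layer_mdist.
move=> /(NP n m Nn Nm)[y yP]; exists (f m y); first by exists y.
by rewrite [mdist _ _]katetov_point_mdist.
Qed.

End Gluing.

(** * The Fell distance *)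

(** As in [loc_cauchy] the target sets are not cut by the ball, so that points close to the bounding
    sphere cause no failure. *)
Definition loc_cvg (R : realType) (Z : bcm R) (z0 : Z) (A : nat -> set Z)
    (B : set Z) :=
  forall r e : R, 0 < e -> exists N, forall n, (N <= n)%N ->
    A n `&` cball z0 r `<=` thicken B e /\ B `&` cball z0 r `<=` thicken (A n) e.

(** * Hausdorff distance between arbitrary sets *)

Section HausdorffDistance.
Variables (R : realType) (M : metricType R).
Implicit Types (A B C : set M) (e : R).
Local Open Scope ereal_scope.

Lemma dH_ge0 A B : 0 <= dH A B.
Proof. by apply: le_ereal_inf_tmp => _ [e [e0 _ _] <-]; rewrite lee_fin. Qed.

Lemma dH_le A B e : (0 <= e)%R -> A `<=` thicken B e -> B `<=` thicken A e ->
  dH A B <= e%:E.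
Proof. by move=> e0 AB BA; apply: ereal_inf_lbound; exists e. Qed.

Lemma dH_lt A B e : dH A B < e%:E -> A `<=` thicken B e /\ B `<=` thicken A e.
Proof.
move=> /ereal_inf_lt[_ [e' [e'0 AB BA] <-]]; rewrite lte_fin => /ltW e'e.
by split=> x; [move/AB|move/BA] => -[y ? xy]; exists y => //; exact: le_trans e'e.
Qed.

Lemma dH_sym A B : dH A B = dH B A.
Proof.
by rewrite /dH; congr ereal_inf; apply/seteqP; split => _ [e [? ? ?] <-]; exists e.
Qed.

Lemma dHxx A : dH A A = 0.
Proof.
apply/eqP; rewrite eq_le dH_ge0 andbT; apply: dH_le => // x Ax;
by exists x => //; rewrite mdistxx.
Qed.

Lemma thicken_trans A B C (e e' : R) :
  A `<=` thicken B e -> B `<=` thicken C e' -> A `<=` thicken C (e + e')%R.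
Proof.
move=> AB BC x /AB[y /BC[z Cz yz] xy]; exists z => //.
by apply: le_trans (metric_triangle _ y _) _; rewrite lerD.
Qed.

Lemma dH_triangle A B C : dH A C <= dH A B + dH B C.
Proof.
have AB0 := dH_ge0 A B; have BC0 := dH_ge0 B C.
have [->|ABy] := eqVneq (dH A B) +oo.
  by rewrite addye ?leey// -ltNye (lt_le_trans _ BC0).
have [->|BCy] := eqVneq (dH B C) +oo.
  by rewrite addey ?leey// -ltNye (lt_le_trans _ AB0).
have ABf : dH A B \is a fin_num by rewrite ge0_fin_numE// ltey.
have BCf : dH B C \is a fin_num by rewrite ge0_fin_numE// ltey.
apply/lee_addgt0Pr => e e0.
have e20 : (0 < e / 2)%R by rewrite divr_gt0.
have [_ [e1 [e10 AB BA] <-] e1e] := lb_ereal_inf_adherent e20 ABf.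
have [_ [e2 [e20' BC CB] <-] e2e] := lb_ereal_inf_adherent e20 BCf.
apply: (@le_trans _ _ (e1 + e2)%:E).
  apply: dH_le; first exact: addr_ge0; first exact: thicken_trans AB BC.
  by rewrite addrC; exact: thicken_trans CB BA.
rewrite -/(dH A B) -/(dH B C) in e1e e2e.
apply: (@le_trans _ _ ((dH A B + (e / 2)%:E) + (dH B C + (e / 2)%:E))).
  by rewrite EFinD leeD// ltW.
by rewrite addeACA -EFinD -splitr.
Qed.

End HausdorffDistance.

(* Strict superlevel sets of the integrand of [dF] are right-open, since compact
   slices are right-continuous in the radius. *)
Lemma right_open_measurable (R : realType) (S : set R) :
  (forall r, S r -> exists2 e, 0 < e & forall r', r <= r' < r + e -> S r') ->
  measurable S.
Proof.
move=> hS.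
(* Each [F q] is an interval, and right-openness makes [S] the union of these countably many
   intervals. *)
pose F (q : rat) : set R :=
  [set r | r <= ratr q /\ forall r', r <= r' <= ratr q -> S r'].
have -> : S = \bigcup_q F q.
  apply/seteqP; split=> [r Sr|r [q _ [rq]]]; last by apply; rewrite lexx.
  have [e e0 eS] := hS r Sr.
  have [|q] := @rat_in_itvoo R r (r + e); first by rewrite ltrDl.
  rewrite in_itv /= => /andP[rq qe]; exists q => //; split; first exact: ltW.
  by move=> r' /andP[rr' r'q]; apply: eS; rewrite rr' (le_lt_trans r'q).
apply: bigcupT_measurable_rat => q; apply: is_interval_measurable.
move=> x y [_ Sx] [yq _] z /andP[xz zy]; split; first exact: le_trans yq.
by move=> r /andP[zr rq]; apply: Sx; rewrite (le_trans xz).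
Qed.

(** * Measurability, metric properties and convergence of the Fell distance *)

Section LocalHausdorff.
Variables (R : realType) (Z : bcm R) (z0 : Z).
Implicit Types (A B C : set Z) (r e : R).

Local Notation slice A r := (A `&` cball z0 r).

Let invS_small e : 0 < e -> exists N, forall n, (N <= n)%N -> n.+1%:R^-1 < e.
Proof.
move=> e0; have [N _ NP] := near_infty_natSinv_lt (PosNum e0).
by exists N => n /NP.
Qed.

Let cluster_dist (u : nat -> Z) (z x : Z) r :
  (forall e N, 0 < e -> exists2 n, (N <= n)%N & mdist x (u n) < e) ->
  (forall n, mdist z (u n) <= r + n.+1%:R^-1) -> mdist z x <= r.
Proof.
move=> ux uz; apply/ler_addgt0Pr => e e0.
have [N NP] := invS_small (divr_gt0 e0 (ltr0Sn R 1)).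
have [n /NP Nn xn] := ux _ N (divr_gt0 e0 (ltr0Sn R 1)).
move: Nn (uz n) xn (metric_triangle z (u n) x); rewrite (metric_sym (u n) x).
by move: (n.+1%:R^-1) => q ? ? ? ?; lra.
Qed.

Let cluster_closed (u : nat -> Z) (x : Z) A : closed A ->
  (forall e N, 0 < e -> exists2 n, (N <= n)%N & mdist x (u n) < e) ->
  (forall n, A (u n)) -> A x.
Proof.
move=> cA ux uA; apply/(closed_mdistP A).1 => // e e0.
by have [n _ xn] := ux e 0%N e0; exists (u n).
Qed.

(** Otherwise points of [B] within [e] of [a], at radii decreasing to at most [r], would cluster at
    a point of [B] in the ball of radius [r] still within [e] of [a]. *)
Lemma slice_gap B (a : Z) r e : closed B ->
  (forall b, B b -> mdist z0 b <= r -> e < mdist a b) ->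
  exists2 eta, 0 < eta & forall b, B b -> mdist z0 b < r + eta -> e < mdist a b.
Proof.
move=> cB gap; apply: contrapT => /forall2NP nogap.
have uP (n : nat) : exists b, [/\ B b, mdist z0 b <= r + n.+1%:R^-1 & mdist a b <= e].
  have [] := nogap n.+1%:R^-1; first by rewrite invr_gt0 ltr0Sn.
  move/existsNP => [b /not_implyP[Bb /not_implyP[bn /negP]]].
  by rewrite -leNgt => ?; exists b; split=> //; exact: ltW.
have [u {}uP] := choice uP.
have [||x _ ux] := @compact_seq R Z (cball z0 (r + 1)) u.
- exact: bcm_compact_ball.
- move=> n; have [_ + _] := uP n; rewrite /cball /= => /le_trans; apply.
  by rewrite lerD2l invf_le1// ler1n.
have := gap x; rewrite ltNge (@cluster_dist u a x e)//; last first.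
  by move=> n; have [_ _ /le_trans] := uP n; apply; rewrite lerDl.
move=> /(_ (cluster_closed cB ux _)) h.
suff : false by []; apply: h; first by move=> n; have [] := uP n.
by apply: cluster_dist ux _ => n; have [] := uP n.
Qed.

Lemma measurable_dH_slice A B : closed A -> closed B ->
  measurable_fun setT (fun r => dH (slice A r) (slice B r)).
Proof.
move=> cA cB.
apply: (measurability _ (ErealGenOInfty.measurableE R)) => // _ [_ [x ->] <-].
rewrite setTI; apply: right_open_measurable => r /=; rewrite in_itv /= andbT => xr.
suff [e [eta [xe eta0 etaP]]] : exists e eta, [/\ x < e, 0 < eta &
    forall r', r <= r' < r + eta -> (e%:E <= dH (slice A r') (slice B r'))%E].
  exists eta => // r' /etaP; rewrite in_itv /= andbT; apply: lt_le_trans.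
  by rewrite lte_fin.
have [x0|x0] := ltP x 0; first by exists 0, 1; split => // r' _; exact: dH_ge0.
(* A failed inclusion persists for slightly larger radii: the offending point remains in the slice,
   and by [slice_gap] no new point of [B'] comes close to it. *)
have one A' B' : closed B' -> forall e, ~ (slice A' r `<=` thicken (slice B' r) e) ->
    exists2 eta, 0 < eta & forall r', r <= r' < r + eta ->
    (e%:E <= dH (slice A' r') (slice B' r'))%E.
  move=> cB' e /existsNP[a /not_implyP[[A'a ar] nB]].
  have [|eta eta0 etaP] := @slice_gap B' a r e cB'.
    by move=> b Bb br; rewrite ltNge; apply/negP => ab; apply: nB; exists b.
  exists eta => // r' /andP[rr' r'eta]; rewrite leNgt; apply/negP => /dH_lt[+ _].
  move=> /(_ a)[|b [Bb br']]; first by split=> //; exact: le_trans rr'.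
  by apply/negP; rewrite -ltNge etaP//; exact: le_lt_trans r'eta.
suff [e xe /not_andP[]] : exists2 e, x < e &
    ~ (slice A r `<=` thicken (slice B r) e /\ slice B r `<=` thicken (slice A r) e).
- by move=> /one[]// eta eta0 etaP; exists e, eta; split.
- move=> /one[]// eta eta0 etaP; exists e, eta; split => // r' /etaP.
  by rewrite dH_sym.
apply: contrapT => /forall2NP h; move: xr; rewrite ltNge => /negP; apply.
apply/lee_addgt0Pr => e e0; rewrite -EFinD.
have [/negP|/contrapT[AB BA]] := h (x + e); first by rewrite ltrDl e0.
by apply: dH_le => //; rewrite addr_ge0// ltW.
Qed.

Let D : set R := `[0, +oo[.

Let mD : measurable D. Proof. exact: measurable_itv. Qed.

Local Open Scope ereal_scope.

Let h A B r := (expR (- r)%R)%:E * mine 1 (dH (slice A r) (slice B r)).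

Lemma integral_expRN : \int[@lebesgue_measure R]_(r in `[0%R, +oo[) (expR (- r))%:E = 1.
Proof.
rewrite -(integral_exponential_pdf (@ltr01 R)) [LHS]integral_mkcond.
apply: eq_integral => r _; rewrite /exponential_pdf !patchE.
by case: ifPn => // _; rewrite mul1r mulN1r.
Qed.

Let measurable_expRN : measurable_fun D (fun r => (expR (- r)%R)%:E).
Proof.
apply/measurable_EFinP; apply: measurable_funTS.
by apply: measurableT_comp => //; exact: oppr_measurable.
Qed.

Let measurable_h A B : closed A -> closed B -> measurable_fun D (h A B).
Proof.
move=> cA cB; apply: emeasurable_funM => //; apply: measurable_mine => //.
by apply: measurable_funTS; exact: measurable_dH_slice.
Qed.

Let min_ge0 A B r : 0 <= mine 1 (dH (slice A r) (slice B r)).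
Proof. by rewrite le_min lee01 dH_ge0. Qed.

Let h_ge0 A B r : 0 <= h A B r.
Proof. by rewrite mule_ge0 ?lee_fin ?expR_ge0. Qed.

Let h_le A B r : h A B r <= (expR (- r)%R)%:E.
Proof. by rewrite -[leRHS]mule1 lee_wpmul2l ?lee_fin ?expR_ge0// ge_min lexx. Qed.

Lemma dF_ge0 A B : 0 <= dF z0 A B.
Proof. by apply: integral_ge0 => r _; exact: h_ge0. Qed.

Lemma dF_le1 A B : closed A -> closed B -> dF z0 A B <= 1.
Proof.
move=> cA cB; rewrite -integral_expRN; apply: ge0_le_integral => //.
- by move=> r _; exact: h_ge0.
- exact: measurable_h.
- by move=> r _; exact: h_le.
Qed.

Lemma dF_sym A B : dF z0 A B = dF z0 B A.
Proof. by apply: eq_integral => r _; rewrite dH_sym. Qed.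

Lemma dFxx A : dF z0 A A = 0.
Proof. by apply: integral0_eq => r _; rewrite dHxx min_r ?mule0// lee01. Qed.

Lemma dF_triangle A B C : closed A -> closed B -> closed C ->
  dF z0 A C <= dF z0 A B + dF z0 B C.
Proof.
move=> cA cB cC; rewrite -ge0_integralD//;
  do ?[exact: measurable_h|by move=> r _; exact: h_ge0].
apply: ge0_le_integral => //.
- by move=> r _; exact: h_ge0.
- exact: measurable_h.
- by apply: emeasurable_funD; exact: measurable_h.
move=> r _; rewrite -ge0_muleDr// lee_wpmul2l ?lee_fin ?expR_ge0//.
set a := dH (slice A r) (slice C r).
have [x1|x1] := leP 1 (dH (slice A r) (slice B r)).
  by rewrite ge_min leeDl.
have [y1|y1] := leP 1 (dH (slice B r) (slice C r)).
  by rewrite ge_min leeDr ?dH_ge0.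
by rewrite ge_min dH_triangle orbT.
Qed.

(** A point of the slice farther than [e] from [B] keeps the Hausdorff distance of the slices at
    least [e] for all radii in [r, r + 1], so the integral is at least [e * expR (- (r + 1))]. The
    bound [e <= 1] keeps the truncation at 1 out of the way. *)
Lemma dF_lt_thicken A B r e : closed A -> closed B ->
  (0 <= r)%R -> (0 < e <= 1)%R -> dF z0 A B < (e * expR (- (r + 1)))%:E ->
  slice A r `<=` thicken B e.
Proof.
move=> cA cB r0 /andP[e0 e1] dFe; apply: contrapT => /existsNP[a].
move=> /not_implyP[[Aa ar] nB]; move: dFe; rewrite ltNge => /negP; apply.
have sub : `[r, (r + 1)%R] `<=` D.
  move=> s; rewrite /D /= !in_itv /= andbT => /andP[rs _]; exact: le_trans rs.
apply: le_trans (ge0_subset_integral (@lebesgue_measure R) _ mD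
  (measurable_h cA cB) _ sub) => //.
have -> : (e * expR (- (r + 1)))%:E =
    \int[@lebesgue_measure R]_(s in `[r, (r + 1)%R]) (e * expR (- (r + 1)))%:E.
  rewrite integral_cst//= lebesgue_measure_itv /= lte_fin ltrDl ltr01.
  by rewrite -EFinD addrAC subrr add0r mule1.
apply: ge0_le_integral => //.
- by move=> s _; rewrite lee_fin mulr_ge0 ?expR_ge0// ltW.
- exact: measurable_funS (measurable_h cA cB).
move=> s /=; rewrite in_itv /= => /andP[rs sr].
rewrite mulrC EFinM; apply: lee_pmul; [by rewrite lee_fin expR_ge0|
  by rewrite lee_fin ltW|by rewrite lee_fin ler_expR lerN2|].
rewrite le_min lee_fin e1 /= leNgt; apply/negP => /dH_lt[/(_ a) + _].
case=> [|b [Bb _] ab]; first by split => //; exact: le_trans rs.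
by apply: nB; exists b.
Qed.

(* The radii at which [A `&` cball z0 r] may fail to be left-continuous in [r]. *)
Definition bad_radii (A : set Z) : set R :=
  [set r | exists x, [/\ A x, mdist z0 x = r & exists2 e : R, (0 < e)%R &
    forall y, A y -> (mdist z0 y < r)%R -> (e <= mdist x y)%R]].

(** Bad radii are sorted by a bound [j] on the radius and a bound [1/(k+1)] on the isolation.
    Witnesses for distinct radii of one class are [1/(k+1)]-separated, the one of smaller radius
    being tested against the other; a compact ball contains only finitely many of them. *)
Lemma countable_bad_radii A : countable (bad_radii A).
Proof.
pose B (kj : nat * nat) : set R := [set r | exists x, [/\ A x, mdist z0 x = r,
  (r <= kj.2%:R)%R &
  forall y, A y -> (mdist z0 y < r)%R -> (kj.1.+1%:R^-1 <= mdist x y)%R]].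
have BA : bad_radii A `<=` \bigcup_kj B kj.
  move=> r [x [Ax xr [e e0 eP]]]; have [k kP] := invS_small e0.
  exists (k, (Num.truncn r).+1) => //; exists x; split => //=.
    by rewrite ltW// truncnS_gt.
  move=> y Ay /(eP y Ay); apply: le_trans; rewrite ltW//; exact: kP.
apply: sub_countable (subset_card_le BA) _; apply: bigcup_countable => // -[k j] _.
apply: finite_set_countable; apply: contrapT => /infiniteP/pcard_leP[f].
have uP (n : nat) : B (k, j) (f n) by exact: funS.
have [u {}uP] := choice uP.
have [||c _ uc] := @compact_seq R Z (cball z0 j%:R) u.
- exact: bcm_compact_ball.
- by move=> n; have [_ + + _] := uP n; rewrite /cball /= => ->.
have q0 : (0 < k.+1%:R^-1 / 2 :> R)%R by rewrite divr_gt0// invr_gt0.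
have [n _ cn] := uc _ 0%N q0; have [m nm cm] := uc _ n.+1 q0.
have unm : (mdist (u n) (u m) < k.+1%:R^-1)%R.
  apply: le_lt_trans (metric_triangle _ c _) _.
  by rewrite [ltRHS]splitr ltrD// metric_sym.
have [An nf _ nP] := uP n; have [Am mf _ mP] := uP m.
have fnm : f n != f m.
  by apply/eqP => fnm; have nm' : n = m := injT fnm; move: nm; rewrite nm' ltnn.
case: (ltgtP (f n) (f m)) fnm => // + _.
  by rewrite -nf => /(mP _ An); rewrite leNgt metric_sym unm.
by rewrite -mf => /(nP _ Am); rewrite leNgt unm.
Qed.

Lemma dH_slice_cvg (An : nat -> set Z) A r e : closed A ->
  loc_cvg z0 An A -> ~ bad_radii A r -> (0 < e)%R ->
  exists N, forall n, (N <= n)%N -> dH (slice (An n) r) (slice A r) <= e%:E.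
Proof.
move=> cA AnA nbad e0; have e20 : (0 < e / 2)%R by rewrite divr_gt0.
(* Inner margin: each point of the slice is close to a point of [A] at depth [etal], whose
   approximations in [An n] stay inside the ball. *)
have [etal etal0 etalP] : exists2 eta : R, (0 < eta)%R & forall x, slice A r x ->
    exists y, [/\ A y, (mdist z0 y <= r - eta)%R & (mdist x y <= e / 2)%R].
  apply: contrapT => /forall2NP noeta.
  have uP (n : nat) : exists x, slice A r x /\ forall y, A y ->
      (mdist z0 y <= r - n.+1%:R^-1)%R -> (e / 2 < mdist x y)%R.
    have [/negP|] := noeta (n.+1%:R^-1)%R; first by rewrite invr_gt0 ltr0Sn.
    move=> /existsNP[x /not_implyP[Ax nx]]; exists x; split => // y Ay yr.
    by rewrite ltNge; apply/negP => xy; apply: nx; exists y.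
  have [u {}uP] := choice uP.
  have [||x xr ux] := @compact_seq R Z (cball z0 r) u.
  - exact: bcm_compact_ball.
  - by move=> n; have [[]] := uP n.
  have Ax : A x by apply: cluster_closed ux _ => // n; have [[]] := uP n.
  suff [y [Ay yr xy]] : exists y, [/\ A y, (mdist z0 y < r)%R & (mdist x y < e / 4)%R].
    have [|N NP] := @invS_small (r - mdist z0 y)%R; first by rewrite subr_gt0.
    have e40 : (0 < e / 4)%R by rewrite divr_gt0.
    have [n /NP Nn xn] := ux _ N e40; have [_ /(_ y Ay)] := uP n.
    rewrite lerBrDr -lerBrDl ltW// => /(_ isT); have := metric_triangle (u n) x y.
    rewrite (metric_sym (u n) x) => ? ?; lra.
  (* A cluster point strictly inside the ball serves as its own [y]; on the sphere, [y] exists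
     because [r] is not a bad radius. *)
  move: xr; rewrite /cball /= le_eqVlt => /orP[/eqP xr|xr]; last first.
    by exists x; split => //; rewrite mdistxx divr_gt0.
  apply: contrapT => noy; apply: nbad; exists x; split => //.
  exists (e / 4)%R; first by rewrite divr_gt0.
  by move=> y Ay yr; rewrite leNgt; apply/negP => xy; apply: noy; exists y.
(* Outer margin: approximations in [A] of points of the other slice may leave the ball by [etar] and
   are still close to the slice of [A]. *)
have [etar etar0 etarP] : exists2 eta : R, (0 < eta)%R & forall x, A x ->
    (mdist z0 x <= r + eta)%R -> thicken (slice A r) (e / 2) x.
  apply: contrapT => /forall2NP noeta.
  have uP (n : nat) : exists x, [/\ A x, (mdist z0 x <= r + n.+1%:R^-1)%R &
      ~ thicken (slice A r) (e / 2) x].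
    have [/negP|] := noeta (n.+1%:R^-1)%R; first by rewrite invr_gt0 ltr0Sn.
    by move=> /existsNP[x /not_implyP[Ax /not_implyP[xr nx]]]; exists x.
  have [u {}uP] := choice uP.
  have [||x _ ux] := @compact_seq R Z (cball z0 (r + 1)) u.
  - exact: bcm_compact_ball.
  - move=> n; have [_ + _] := uP n; rewrite /cball /= => /le_trans; apply.
    by rewrite lerD2l invf_le1// ler1n.
  have Ax : A x by apply: cluster_closed ux _ => // n; have [] := uP n.
  have xr : (mdist z0 x <= r)%R by apply: cluster_dist ux _ => n; have [] := uP n.
  have [n _ xn] := ux _ 0%N e20; have [_ _] := uP n; apply.
  by exists x; rewrite // metric_sym ltW.
pose e' := Num.min (e / 2)%R (Num.min etal etar).
have e'0 : (0 < e')%R by rewrite !lt_min e20 etal0.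
have [N NP] := AnA r e' e'0; exists N => n /NP[AnP AP].
have [e'e [e'l e'r]] : (e' <= e / 2 /\ e' <= etal /\ e' <= etar)%R.
  by rewrite !ge_min !lexx ?orbT.
apply: dH_le; first exact: ltW.
- move=> x [Anx xr]; have [|y Ay xy] := AnP x; first by [].
  have [|z Az yz] := etarP y Ay.
    by move: xr (metric_triangle z0 x y); rewrite /cball /= => ? ?; lra.
  exists z => //; have := metric_triangle x y z => ?; lra.
- move=> x Ax; have [y [Ay yr xy]] := etalP x Ax.
  have [|z Anz yz] := AP y; first by split => //; rewrite /cball /=; lra.
  have := metric_triangle z0 y z; have := metric_triangle x y z => ? ?.
  by exists z; [split => //; rewrite /cball /=; lra|lra].
Qed.

(** Dominated convergence with dominating function [expR (- r)]: the integrands tend to zero off the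
    bad radii of [A], a countable and hence null set. *)
Lemma dF_cvg (An : nat -> set Z) A e : (forall n, closed (An n)) -> closed A ->
  loc_cvg z0 An A -> (0 < e)%R ->
  exists N, forall n, (N <= n)%N -> dF z0 (An n) A < e%:E.
Proof.
move=> cAn cA AnA e0.
have [||||| _ _ h0] := @dominated_convergence _ _ R (@lebesgue_measure R) D mD
  (fun n => h (An n) A) (cst 0) (fun r => (expR (- r)%R)%:E).
- by move=> n; exact: measurable_h.
- exact: measurable_cst.
- have cbad := countable_bad_radii A.
  exists (bad_radii A); split;
    [exact: countable_measurable|exact: countable_lebesgue_measure0|].
  move=> r /= nr; apply: contrapT => nbad; apply: nr => r0.
  apply/fine_cvgP; split.
    apply: nearW => n; rewrite ge0_fin_numE//.
    exact: le_lt_trans (h_le _ _ _) (ltry _).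
  apply/cvgrPdist_lt => /= d d0.
  have [N NP] := dH_slice_cvg cA AnA nbad (divr_gt0 d0 (ltr0Sn R 1)).
  exists N => // n /NP /= dHd; rewrite sub0r normrN.
  have hd : h (An n) A r <= (d / 2)%:E.
    apply: le_trans dHd; rewrite -[leRHS]mul1e; apply: lee_pmul => //.
    - rewrite lee_fin -expR0 ler_expR oppr_le0.
      by move: r0; rewrite /D /= in_itv /= andbT.
    - by rewrite ge_min lexx orbT.
  have hf : h (An n) A r \is a fin_num.
    by rewrite ge0_fin_numE//; exact: le_lt_trans hd (ltry _).
  rewrite ger0_norm ?fine_ge0// -lte_fin fineK//.
  by apply: le_lt_trans hd _; rewrite lte_fin ltr_pdivrMr// ltr_pMr// ltr1n.
- apply/integrableP; split => //.
  under eq_integral do rewrite gee0_abs ?lee_fin ?expR_ge0//.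
  by rewrite integral_expRN ltry.
- by apply: aeW => r n _; rewrite gee0_abs.
rewrite integral_cst//= mul0e in h0.
move/fine_cvgP : h0 => [[N1 _ N1P] /cvgrPdist_lt/(_ _ e0)[N2 _ N2P]].
exists (maxn N1 N2) => n; rewrite geq_max => /andP[/N1P/= fn /N2P /=].
rewrite sub0r normrN -lte_fin => /(le_lt_trans _); apply.
by rewrite -[leLHS]fineK// lee_fin ler_norm.
Qed.

Lemma dF_isometry (Z' : bcm R) (k : iso_emb Z Z') A B :
  dF (k z0) (k @` A) (k @` B) = dF z0 A B.
Proof.
have slk C r : (k @` C) `&` cball (k z0) r = k @` slice C r.
  apply/seteqP; split => [_ [[x Cx <-]]|_ [x [Cx xr] <-]].
    by rewrite /cball /= iso_emb_mdist => ?; exists x.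
  by split; [exists x|rewrite /cball /= iso_emb_mdist].
have thk (C C' : set Z) e : k @` C `<=` thicken (k @` C') e <-> C `<=` thicken C' e.
  split=> CC' x => [Cx|[y Cy <-]].
    have [|_ [y C'y <-]] := CC' (k x); first by exists x.
    by rewrite iso_emb_mdist => ?; exists y.
  have [z C'z yz] := CC' y Cy.
  by exists (k z); [exists z|rewrite iso_emb_mdist].
apply: eq_integral => r _; rewrite !slk; congr (_ * mine _ (ereal_inf _)).
apply/seteqP; split => _ [e [e0 H1 H2] <-]; exists e => //; split => //;
  exact/thk.
Qed.

End LocalHausdorff.

(** * Local limits of closed sets *)

Section LocalLimit.
Variables (R : realType) (Z : bcm R) (z0 : Z).

(** The lower limit of the sets in the sense of Kuratowski. *)
Definition loc_limit (A : nat -> set Z) : set Z := [set z | forall e : R, 0 < e ->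
  exists N, forall n, (N <= n)%N -> exists2 y, A n y & mdist z y <= e].

Lemma closed_loc_limit A : closed (loc_limit A).
Proof.
apply/closed_mdistP => z zA e e0; have e20 : 0 < e / 2 by rewrite divr_gt0.
have [y yA zy] := zA _ e20; have [N NP] := yA _ e20.
exists N => n /NP[x Ax yx]; exists x => //.
by have := metric_triangle z y x => ?; lra.
Qed.

(** A point of [A n] is followed by nearby points of all later sets; these cluster by compactness of
    balls, and the Cauchy property places the cluster point in the limit set. *)
Lemma loc_limit_cvg A : loc_cauchy z0 A -> loc_cvg z0 A (loc_limit A).
Proof.
move=> AC r e e0; have e20 : 0 < e / 2 by rewrite divr_gt0.
have [N1 NP1] := AC r _ e0; have [N2 NP2] := AC (r + e) _ e20.
exists (maxn N1 N2) => n; rewrite geq_max => /andP[n1 n2]; split; last first.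
  move=> z [zA zr]; have [N NP] := zA _ e20.
  have [y Ay zy] := NP _ (leq_maxl N N2).
  have [|x Ax yx] := NP2 _ n (leq_maxr N N2) n2 y.
    split => //; move: zr (metric_triangle z0 z y); rewrite /cball /= => ? ?; lra.
  by exists x => //; have := metric_triangle z y x => ?; lra.
move=> x [Anx xr].
have uP (k : nat) : exists y, A (N1 + k)%N y /\ mdist x y <= e.
  by have [|y Ay xy] := NP1 n (N1 + k)%N n1 (leq_addr _ _) x; last by exists y.
have [u {}uP] := choice uP.
have [||z xz uz] := @compact_seq R Z (cball x e) u.
- exact: bcm_compact_ball.
- by move=> k; have [] := uP k.
exists z => // d d0; have d20 : 0 < d / 2 by rewrite divr_gt0.
have [N NP] := AC (r + e) _ d20; have [k Nk zk] := uz _ N d20.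
exists N => m Nm; have [Ak xk] := uP k.
have [||y Ay ky] := NP (N1 + k)%N m _ Nm (u k); first by rewrite (leq_trans Nk) ?leq_addl.
  by split => //; move: xr (metric_triangle z0 x (u k)); rewrite /cball /= => ? ?; lra.
by exists y => //; have := metric_triangle z (u k) y => ?; lra.
Qed.

Lemma loc_limit_mem (A : nat -> set Z) z : (forall n, A n z) -> loc_limit A z.
Proof. by move=> Az e e0; exists 0%N => n _; exists z; rewrite // mdistxx ltW. Qed.

Lemma compact_bounded_cball (K : set Z) : compact K -> exists r : R, K `<=` cball z0 r.
Proof.
move=> cK; apply: contrapT => /forallNP h.
have uP (n : nat) : exists z, K z /\ n%:R < mdist z0 z.
  have /existsNP[z /not_implyP[Kz /negP]] := h n%:R.
  by rewrite -ltNge => ?; exists z.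
have [u {}uP] := choice uP.
have [|z Kz uz] := compact_seq cK (u := u); first by move=> n; have [] := uP n.
have [n Nn zn] := uz 1 (Num.truncn (mdist z0 z + 1)).+1 ltr01.
have [_ un] := uP n; have := truncnS_gt (mdist z0 z + 1) => tr.
have : (Num.truncn (mdist z0 z + 1)).+1%:R <= n%:R :> R by rewrite ler_nat.
move: tr; move: (_.+1%:R) => t ? ?; have := metric_triangle z0 z (u n) => ?; lra.
Qed.

Lemma loc_cvg_fell (A : nat -> fell Z) (B : fell Z) :
  loc_cvg z0 A B -> A @ \oo --> B.
Proof.
move=> AB; have sub W : fell_subbase W -> W B -> \forall n \near \oo, W (A n).
  move=> [[K cK ->]|[U oU ->]] /=; last first.
    move=> [z [Bz Uz]]; have /mdist_nearP[e e0 zU] : nbhs z U.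
      by apply: open_nbhs_nbhs.
    have [N NP] := AB (mdist z0 z) (e / 2) (divr_gt0 e0 (ltr0Sn R 1)).
    exists N => // n /NP[_ /(_ z)[|y Ay zy]]; first by split; rewrite /cball /=.
    by exists y; split => //; apply: zU; lra.
  move=> BK; have [r Kr] := compact_bounded_cball cK.
  (* A compact set disjoint from a closed set is at positive distance from it. *)
  have [e e0 eP] : exists2 e : R, 0 < e &
      forall z y, K z -> fell_set B y -> e < mdist z y.
    apply: contrapT => /forall2NP h.
    have uP (n : nat) : exists z, K z /\
        exists2 y, fell_set B y & mdist z y <= n.+1%:R^-1.
      have [/negP|] := h (n.+1%:R^-1); first by rewrite invr_gt0 ltr0Sn.
      move=> /existsNP[z /existsNP[y /not_implyP[Kz /not_implyP[By /negP]]]].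
      by rewrite -leNgt => ?; exists z; split => //; exists y.
    have [u {}uP] := choice uP.
    have [|z Kz uz] := compact_seq cK (u := u); first by move=> n; have [] := uP n.
    suff Bz : fell_set B z by have : (B `&` K) z by []; rewrite BK.
    have /closed_mdistP : closed (fell_set B) by exact: fell_closed.
    apply=> e e0.
    have e20 : 0 < e / 2 by rewrite divr_gt0.
    have [N _ NP] := near_infty_natSinv_lt (PosNum e20).
    have [n Nn zn] := uz _ N e20; have [_ [y By yn]] := uP n.
    exists y => //; have := NP n Nn; have := metric_triangle z (u n) y; move: yn.
    by rewrite /=; move: (n.+1%:R^-1) => q ? ? ?; lra.
  have [N NP] := AB r e e0; exists N => // n /NP[An _]; rewrite -subset0.
  move=> z [Az Kz]; have [|y By zy] := An z; first by split => //; exact: Kr.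
  by have := eP z y Kz By; rewrite ltNge zy.
(* A neighbourhood contains a finite intersection of subbasic sets around [B], so the subbasic case
   suffices. *)
move=> W; rewrite nbhsE => -[V [oV VB] VW]; apply: filterS VW _.
have [D' D'sub VE] : [set \bigcup_(i in D') i | D' in
  subset^~ (finI_from (@fell_subbase Z) id)] V by exact: oV.
move: VB; rewrite -VE => -[V' D'V' V'B].
have [S Ssub V'E] := D'sub _ D'V'.
rewrite nbhs_filterE; apply: (@filterS _ _ _ V'); first by move=> x V'x; exists V'.
rewrite -V'E; apply: filter_bigI => i Si; apply: sub.
  by have := Ssub i Si; rewrite inE.
by move: V'B; rewrite -V'E; exact.
Qed.

End LocalLimit.

(** * Limits of embeddings and transfer of couplings *)

Section EmbeddingLimits.
Variables (R : realType) (X Z : bcm R) (x0 : X) (z0 : Z).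
Variable h : nat -> iso_emb X Z.
Hypothesis h0 : forall n, h n x0 = z0.

(* Arzela-Ascoli for root-preserving isometric embeddings: take the pointwise
   limit along a free ultrafilter. *)
Lemma iso_emb_subseq : exists (g : iso_emb X Z) (s : nat -> nat),
  [/\ g x0 = z0, forall k, (k <= s k)%N &
      forall k x, mdist x0 x <= k%:R -> mdist (g x) (h (s k) x) <= k.+1%:R^-1].
Proof.
have [U [UU ooU]] := ultraFilterLemma (@eventually_filter).
have gP x : exists y, forall e : R, 0 < e -> U [set n | mdist y (h n x) < e].
  have cb : compact (cball z0 (mdist x0 x)) by exact: bcm_compact_ball.
  have [|y _ yP] := (compact_ultraP _).1 cb _ (ultra_fmap (fun n => h n x) UU).
    apply: ooU; exists 0%N => // n _ /=.
    by rewrite /cball /= -(h0 n) iso_emb_mdist.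
  by exists y => e e0; exact: yP.
have [g {}gP] := choice gP.
have gd x y : mdist (g x) (g y) = mdist x y.
  apply/eqP; rewrite eq_le; apply/andP; split; apply/ler_addgt0Pr => e e0;
    have e20 : 0 < e / 2 by rewrite divr_gt0.
    have [n [/= nx ny]] := filterI_ex (gP x _ e20) (gP y _ e20).
    have := metric_triangle (g x) (h n x) (g y).
    have := metric_triangle (h n x) (h n y) (g y).
    rewrite iso_emb_mdist (metric_sym (h n y)) => ? ?; lra.
  have [n [/= nx ny]] := filterI_ex (gP x _ e20) (gP y _ e20).
  rewrite -(iso_emb_mdist (h n)).
  have := metric_triangle (h n x) (g x) (h n y).
  have := metric_triangle (g x) (g y) (h n y).
  rewrite (metric_sym (h n x) (g x)) => ? ?; lra.
have sP k : exists n, (k <= n)%N /\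
    forall x, mdist x0 x <= k%:R -> mdist (g x) (h n x) <= k.+1%:R^-1.
  pose S := [set n | forall x, mdist x0 x <= k%:R -> mdist (g x) (h n x) <= k.+1%:R^-1].
  have kU : U [set n | (k <= n)%N] by apply: ooU; exists k.
  have [US|USC] := in_ultra_setVsetC S UU.
    by have [n []] := filterI_ex kU US; exists n.
  (* Pointwise convergence is upgraded to uniform convergence on the ball: bad points [u n] would
     converge along the ultrafilter to some [x], and convergence at [x] together with the isometry
     property gives a contradiction in three steps of a third each. *)
  exfalso; have uP (n : nat) : exists x, ~ S n ->
      mdist x0 x <= k%:R /\ k.+1%:R^-1 < mdist (g x) (h n x).
    have [?|/existsNP[x /not_implyP[xk /negP]]] := pselect (S n); first by exists x0.
    by rewrite -ltNge => ?; exists x.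
  have [u {}uP] := choice uP.
  have cb : compact (cball x0 k%:R) by exact: bcm_compact_ball.
  have uF : U (u @^-1` cball x0 k%:R).
    by apply: filterS USC => n nS; have [+ _] := uP n nS.
  have [x _ xU] := (compact_ultraP _).1 cb _ (ultra_fmap u UU) uF.
  have q0 : 0 < (k.+1%:R^-1 / 3 : R) by rewrite divr_gt0 ?invr_gt0.
  have xuU : U [set n | mdist x (u n) < k.+1%:R^-1 / 3] by exact: xU.
  have [n [[/= xn gn] nS]] := filterI_ex (filterI xuU (gP x _ q0)) USC.
  have [_] := uP n nS; rewrite ltNge => /negP; apply.
  have := metric_triangle (g (u n)) (g x) (h n (u n)).
  have := metric_triangle (g x) (h n x) (h n (u n)).
  rewrite iso_emb_mdist gd (metric_sym (u n)); move: xn gn.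
  by move: (k.+1%:R^-1) => q ? ? ? ?; lra.
have [s {}sP] := choice sP.
exists (IsoEmb gd), s; split => [/=|k|k x /=].
- apply: mdist_positivity; apply/eqP; rewrite eq_le mdist_ge0 andbT.
  apply/ler_addgt0Pr => e /(gP x0)/filter_ex[n /=].
  by rewrite h0 add0r => /ltW.
- by have [] := sP k.
- by have [_] := sP k; apply.
Qed.

End EmbeddingLimits.

Lemma iso_emb_cvg_uniform (R : realType) (X Z : bcm R) (x0 : X)
    (h : nat -> iso_emb X Z) (g : iso_emb X Z) :
  (forall k x, mdist x0 x <= k%:R -> mdist (g x) (h k x) <= k.+1%:R^-1) ->
  forall K : set X, compact K ->
    {uniform K, (fun n => h n : X -> Z) @ \oo --> (g : X -> Z)}.
Proof.
move=> hg K cK; have [r Kr] := compact_bounded_cball x0 cK.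
move=> P /uniform_nbhs[E [entE EP]].
have [e /= e0 eE] : exists2 e : R, 0 < e & [set xy | ball xy.1 e xy.2] `<=` E.
  by move: entE; rewrite -entourage_ballE => -[e e0 eE]; exists e.
have [N _ NP] := near_infty_natSinv_lt (PosNum e0).
exists (maxn N (Num.truncn r).+1) => // n /=; rewrite geq_max => /andP[Nn rn].
apply: EP => x Kx; apply: eE => /=; rewrite ballEmdist /=.
apply: le_lt_trans (NP n Nn); apply: hg; apply: le_trans (Kr x Kx) _.
by apply: le_trans (ltW (truncnS_gt r)) _; rewrite ler_nat.
Qed.

Section CouplingTransfer.
Variables (R : realType) (X Y Z Z' : bcm R).
Variables (f : iso_emb X Z) (g : iso_emb Y Z).
Variables (f' : iso_emb X Z') (g' : iso_emb Y Z').
Hypothesis fg : forall x y, mdist (f x) (g y) = mdist (f' x) (g' y).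

(* Both couplings factor through the subspace [range f `|` range g]. *)
Lemma coupling_factor : exists (W : bcm R) (i : iso_emb W Z) (j : iso_emb W Z')
    (f0 : iso_emb X W) (g0 : iso_emb Y W),
  [/\ f = iso_emb_comp i f0, g = iso_emb_comp i g0,
      f' = iso_emb_comp j f0 & g' = iso_emb_comp j g0].
Proof.
pose A := range f `|` range g.
have cA : closed A by apply: closedU; exact: closed_range_iso_emb.
have A0 : A !=set0.
  by have [x _] := bcm_nonempty X; exists (f x); left; exists x.
pose i := sub_bcm_val cA A0.
have [f0 f0P] : exists f0 : iso_emb X (sub_bcm cA A0), forall x, i (f0 x) = f x.
  by apply: iso_emb_factor; rewrite range_sub_bcm_val => z; left.
have [g0 g0P] : exists g0 : iso_emb Y (sub_bcm cA A0), forall y, i (g0 y) = g y.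
  by apply: iso_emb_factor; rewrite range_sub_bcm_val => z; right.
(* A point may lie in both ranges, so [j] is first a relation; equality of the cross distances makes
   it isometric, hence single-valued. *)
pose rel z z' := (exists2 x, z = f x & z' = f' x) \/ (exists2 y, z = g y & z' = g' y).
have relE z1 z1' z2 z2' : rel z1 z1' -> rel z2 z2' -> mdist z1' z2' = mdist z1 z2.
  move=> [[a -> ->]|[a -> ->]] [[b -> ->]|[b -> ->]].
  - by rewrite !iso_emb_mdist.
  - by rewrite fg.
  - by rewrite metric_sym -fg metric_sym.
  - by rewrite !iso_emb_mdist.
have jP (w : sub_bcm cA A0) : exists z', rel (i w) z'.
  have : range i (i w) by exists w.
  rewrite range_sub_bcm_val => -[[x _ <-]|[y _ <-]].
    by exists (f' x); left; exists x.
  by exists (g' y); right; exists y.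
have [j {}jP] := choice jP.
have jd w w' : mdist (j w) (j w') = mdist w w'.
  by rewrite (relE _ _ _ _ (jP w) (jP w')) iso_emb_mdist.
have rel_uniq z z' w : rel z z' -> rel z w -> w = z'.
  by move=> h1 h2; apply: mdist_positivity; rewrite (relE _ _ _ _ h2 h1) mdistxx.
exists (sub_bcm cA A0), i, (IsoEmb jd), f0, g0; split; apply: iso_emb_eq => t /=.
- by rewrite -f0P.
- by rewrite -g0P.
- by apply: rel_uniq (jP (f0 t)) _; rewrite f0P; left; exists t.
- by apply: rel_uniq (jP (g0 t)) _; rewrite g0P; right; exists t.
Qed.

Lemma dF_transfer x0 :
  dF (f x0) (range f) (range g) = dF (f' x0) (range f') (range g').
Proof.
have [W [i [j [f0 [g0 [-> -> -> ->]]]]]] := coupling_factor.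
have rangeE (V U1 U2 : bcm R) (k : iso_emb U1 U2) (k0 : iso_emb V U1) :
    range (iso_emb_comp k k0) = k @` range k0.
  by apply/seteqP; split=> [_ [v _ <-]|_ [_ [v _ <-] <-]];
    [exists (k0 v) => //; exists v|exists v].
by rewrite !rangeE /= !dF_isometry.
Qed.

Lemma srm_transfer (tau : structure R) (s : srm tau) x0 a b :
  srm_dist s (f x0) (structure_map tau f a) (structure_map tau g b) =
  srm_dist s (f' x0) (structure_map tau f' a) (structure_map tau g' b).
Proof.
have [W [i [j [f0 [g0 [-> -> -> ->]]]]]] := coupling_factor.
by rewrite !structure_map_comp !(srm_map _ (rhoX := f0 x0)).
Qed.

End CouplingTransfer.

(** * Couplings of triples *)

Lemma metric_cvgP (R : realType) (T : topologicalType) (d : T -> T -> R)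
    (u : nat -> T) (l : T) : is_metric d -> induces_topology d ->
  (u @ \oo --> l) <->
  (forall e : R, 0 < e -> exists N, forall n, (N <= n)%N -> d (u n) l < e).
Proof.
move=> dm dt; split=> [ul e e0|ul A].
  have [|N _ NP] := ul [set y | d y l < e]; last by exists N.
  apply: open_nbhs_nbhs; split; last by rewrite /= (is_metric_eq0 dm l l).2.
  apply/dt => x /= xl; exists (e - d x l); first by rewrite subr_gt0.
  move=> y /= xy; have := is_metric_triangle dm y x l.
  rewrite (is_metric_sym dm y x) => ?; lra.
rewrite nbhsE => -[B [oB Bl] BA]; have [e e0 eB] := (dt B).1 oB l Bl.
have [N NP] := ul e e0; exists N => // n Nn /=; apply/BA/eB => /=.
by rewrite (is_metric_sym dm) NP.
Qed.

Section Triples.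
Variables (R : realType) (tau : structure R) (s : srm tau).
Implicit Types (x y z : triple tau) (e : R).

Definition close x y e : Prop :=
  exists (Z : bcm R) (f : iso_emb (tspace x) Z) (g : iso_emb (tspace y) Z),
  [/\ f (troot x) = g (troot y),
      (dF (f (troot x)) (range f) (range g) < e%:E)%E &
      srm_dist s (f (troot x)) (structure_map tau f (tpoint x))
        (structure_map tau g (tpoint y)) < e].

(** All realizations of [delta] are quantified over, so that a cost found in one space can be read
    in the glued space. *)
Definition coupling_cost x y (delta : tspace x -> tspace y -> R) e : Prop :=
  forall (Z : bcm R) (f : iso_emb (tspace x) Z) (g : iso_emb (tspace y) Z),
  (forall a b, mdist (f a) (g b) = delta a b) ->
  (dF (f (troot x)) (range f) (range g) < e%:E)%E /\
  srm_dist s (f (troot x)) (structure_map tau f (tpoint x))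
    (structure_map tau g (tpoint y)) < e.

Definition coupling_near x y (delta : tspace x -> tspace y -> R) (r q : R) :=
  (forall a, mdist (troot x) a <= r -> exists b, delta a b <= q) /\
  (forall b, mdist (troot y) b <= r -> exists a, delta a b <= q).

Lemma dtriple_lt x y e : (dtriple s x y < e%:E)%E <-> close x y e.
Proof.
split=> [/ereal_inf_lt[_ [Z [rho [f [g [fr gr ->]]]]]]|[Z [f [g [fg dFe se]]]]].
  rewrite gt_max lte_fin => /andP[dFe se].
  by exists Z, f, g; split; rewrite ?fr.
apply: le_lt_trans (_ : (Order.max (dF (f (troot x)) (range f) (range g))
    (srm_dist s (f (troot x)) (structure_map tau f (tpoint x))
       (structure_map tau g (tpoint y)))%:E < e%:E)%E).
  by apply: ereal_inf_lbound; exists Z, (f (troot x)), f, g.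
by rewrite gt_max dFe lte_fin.
Qed.

Lemma dtriple_ge0 x y : (0 <= dtriple s x y)%E.
Proof.
apply: le_ereal_inf_tmp => _ [Z [rho [f [g [_ _ ->]]]]].
by rewrite le_max dF_ge0.
Qed.

Lemma close_sym x y e : close x y e -> close y x e.
Proof.
move=> [Z [f [g [fg dFe se]]]]; exists Z, g, f; rewrite -fg; split => //.
- by rewrite dF_sym.
- by rewrite (is_metric_sym (srm_metric s _)).
Qed.

Lemma close_refl x e : 0 < e -> close x x e.
Proof.
move=> e0; exists (tspace x), (iso_emb_id _), (iso_emb_id _); split => //.
  by rewrite dFxx.
by rewrite (is_metric_eq0 (srm_metric s _) _ _).2.
Qed.

Lemma close_coupling x y e : close x y e ->
  exists delta : tspace x -> tspace y -> R,
  [/\ is_coupling (troot x) (troot y) delta, coupling_cost delta e &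
      forall r q, 0 <= r -> 0 < q <= 1 -> e <= q * expR (- (r + 1)) ->
      coupling_near delta r q].
Proof.
move=> [Z [f [g [fg dFe se]]]]; exists (fun a b => mdist (f a) (g b)); split.
- split.
  + by rewrite fg mdistxx.
  + by move=> a a' b; rewrite -(iso_emb_mdist f); exact: metric_triangle.
  + by move=> a b b'; rewrite -(iso_emb_mdist g); exact: metric_triangle.
  + move=> a a' b; rewrite -(iso_emb_mdist f) (metric_sym (f a')).
    exact: metric_triangle.
  + move=> a b b'; rewrite -(iso_emb_mdist g) (metric_sym (f a) (g b)).
    exact: metric_triangle.
- move=> Z' f' g' fgd; rewrite -(dF_transfer (f := f) (g := g)) //.
  by rewrite -(srm_transfer (f := f) (g := g)).
move=> r q r0 q01 eq.
have cf := @closed_range_iso_emb R _ _ f; have cg := @closed_range_iso_emb R _ _ g.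
have dFq : (dF (f (troot x)) (range f) (range g) < (q * expR (- (r + 1)))%:E)%E.
  by apply: lt_le_trans dFe _; rewrite lee_fin.
split=> [a ar|b br].
- have far : (range f `&` cball (f (troot x)) r) (f a).
    by split; [exists a|rewrite /cball /= iso_emb_mdist].
  by have [_ [b _ <-] ab] := dF_lt_thicken cf cg r0 q01 dFq far; exists b.
- have gbr : (range g `&` cball (f (troot x)) r) (g b).
    by split; [exists b|rewrite /cball /= fg iso_emb_mdist].
  rewrite dF_sym in dFq.
  have [_ [a _ <-] ab] := dF_lt_thicken cg cf r0 q01 dFq gbr.
  by exists a; rewrite metric_sym.
Qed.

(** In the bound [2 ^- n * 2 ^- n], one factor is the precision of the n-th coupling; the other is
    eventually below [expR (- (r + 1))], whatever the radius. *)
Lemma close_gluing (x : nat -> triple tau) (e : nat -> R) :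
  (forall n, close (x n) (x n.+1) (e n)) ->
  (exists N, forall n, (N <= n)%N -> e n <= 2 ^- n * 2 ^- n) ->
  exists (Z : bcm R) (z0 : Z) (f : forall n, iso_emb (tspace (x n)) Z),
  [/\ forall n, f n (troot (x n)) = z0,
      forall n, (dF z0 (range (f n)) (range (f n.+1)) < (e n)%:E)%E,
      forall n, srm_dist s z0 (structure_map tau (f n) (tpoint (x n)))
                  (structure_map tau (f n.+1) (tpoint (x n.+1))) < e n &
      loc_cauchy z0 (fun n => range (f n))].
Proof.
move=> xe [N NP].
pose delta n := sval (cid (close_coupling (xe n))).
have deltaP n : [/\ is_coupling (troot (x n)) (troot (x n.+1)) (@delta n),
    coupling_cost (@delta n) (e n) &
    forall r q, 0 <= r -> 0 < q <= 1 -> e n <= q * expR (- (r + 1)) ->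
    coupling_near (@delta n) r q].
  by rewrite /delta; case: cid.
have [||Z [z0 [f [f0 fd fC]]]] := @gluing R (fun n => tspace (x n))
  (fun n => troot (x n)) delta.
- by move=> n; have [] := deltaP n.
(* The matching of points is available for nonnegative radii only. *)
- move=> r; pose r' := Num.max r 0.
  have [N' N'P] := exp2N_small (expR_gt0 (- (r' + 1))).
  exists (maxn N N') => n; rewrite geq_max => /andP[Nn N'n].
  have [_ _ /(_ r' (2 ^- n))[]] := deltaP n.
  + by rewrite le_max lexx orbT.
  + by rewrite invr_gt0 exprn_gt0//= invf_le1 ?exprn_gt0// exprn_ege1// ler1n.
  + apply: le_trans (NP n Nn) _; rewrite ler_pM2l ?invr_gt0 ?exprn_gt0//.
    by rewrite ltW// N'P.
  + move=> up down; split => [a ar|b br].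
      by apply: up; rewrite le_max ar.
    by apply: down; rewrite le_max br.
have costP n := let: And3 _ c _ := deltaP n in c Z (f n) (f n.+1) (fd n).
exists Z, z0, f; split => // n.
- by have [+ _] := costP n; rewrite f0.
- by have [_] := costP n; rewrite f0.
Qed.

Lemma close_triangle x y z e1 e2 :
  close x y e1 -> close y z e2 -> close x z (e1 + e2).
Proof.
move=> xy yz.
pose t n := if n is n'.+1 then (if n' is _.+1 then z else y) else x.
pose e n := if n is n'.+1 then (if n' is _.+1 then 2 ^- n * 2 ^- n else e2) else e1.
have [||Z [z0 [f [f0 fF fs _]]]] := @close_gluing t e.
- by case=> [|[|n]] //; apply: close_refl; rewrite mulr_gt0 ?invr_gt0 ?exprn_gt0.
- by exists 2%N; case=> [|[|n]].
exists Z, (f 0%N), (f 2%N); rewrite (f0 0%N) (f0 2%N); split => //.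
- have cl n : closed (range (f n)) by exact: closed_range_iso_emb.
  apply: le_lt_trans (dF_triangle z0 (cl 0%N) (cl 1%N) (cl 2%N)) _.
  by rewrite EFinD; apply: lteD; [exact: (fF 0%N)|exact: (fF 1%N)].
- apply: le_lt_trans (is_metric_triangle (srm_metric s _) _
    (structure_map tau (f 1%N) (tpoint (t 1%N))) _) _.
  by apply: ltrD; [exact: (fs 0%N)|exact: (fs 1%N)].
Qed.

Lemma close_exists x y : exists e, close x y e.
Proof.
pose t n := if n is _.+1 then y else x.
pose delta n : tspace (t n) -> tspace (t n.+1) -> R :=
  if n is _.+1 then fun a b => mdist a b
  else fun a b => mdist (troot x) a + mdist (troot y) b.
have [||Z [z0 [f [f0 fd fC]]]] := @gluing R (fun n => tspace (t n))
  (fun n => troot (t n)) delta.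
- case=> [|n]; split => /=.
  + by rewrite !mdistxx addr0.
  + move=> a a' b; have := metric_triangle (troot x) a' a.
    rewrite (metric_sym a') => ?; lra.
  + by move=> a b b'; have := metric_triangle (troot y) b' b => ?; lra.
  + move=> a a' b; have := metric_triangle a (troot x) a'.
    rewrite (metric_sym a (troot x)); have := mdist_ge0 (troot y) b => ? ?; lra.
  + move=> a b b'; have := metric_triangle b (troot y) b'.
    rewrite (metric_sym b (troot y)); have := mdist_ge0 (troot x) a => ? ?; lra.
  + exact: mdistxx.
  + by move=> a a' b; exact: metric_triangle.
  + by move=> a b b'; exact: metric_triangle.
  + by move=> a a' b; rewrite (metric_sym a' b); exact: metric_triangle.
  + by move=> a b b'; rewrite (metric_sym a b); exact: metric_triangle.
- move=> r; exists 1%N; case=> // n _; split => a ar; exists a => /=;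
  by rewrite mdistxx invr_ge0 exprn_ge0.
have dF1 := dF_le1 (f 0%N (troot x)) (@closed_range_iso_emb R _ _ (f 0%N))
  (@closed_range_iso_emb R _ _ (f 1%N)).
pose e := srm_dist s (f 0%N (troot x)) (structure_map tau (f 0%N) (tpoint x))
  (structure_map tau (f 1%N) (tpoint y)).
have e0 : 0 <= e := is_metric_ge0 (srm_metric s _) _ _.
(* The Fell part is at most 1 and the structure part is [e], so [e + 2] exceeds both. *)
exists (e + 2), Z, (f 0%N), (f 1%N); split.
- by rewrite (f0 0%N) -(f0 1%N).
- by apply: le_lt_trans dF1 _; rewrite lte_fin; lra.
- by rewrite -/e; lra.
Qed.

Lemma dtriple_fin_num x y : dtriple s x y \is a fin_num.
Proof.
have [e /dtriple_lt xye] := close_exists x y.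
by rewrite ge0_fin_numE ?dtriple_ge0//; apply: lt_trans xye (ltry _).
Qed.

End Triples.

(** * The metric on classes of triples *)

Lemma geometric_cvg (R : realType) (T : Type) (d : T -> T -> R) (u : nat -> T) :
  is_metric d -> complete_metric d ->
  (forall n, d (u n) (u n.+1) < 2 ^- n) ->
  exists l, forall e : R, 0 < e -> exists N, forall n, (N <= n)%N -> d (u n) l < e.
Proof.
move=> dm dC du; apply: dC => e e0.
have step n k : d (u n) (u (k + n)%N) <= 2 * 2 ^- n - 2 * 2 ^- (k + n).
  elim: k => [|k IH]; first by rewrite subrr (is_metric_eq0 dm _ _).2.
  have := is_metric_triangle dm (u n) (u (k + n)%N) (u (k + n).+1).
  have : 2 ^- (k + n) = 2 * 2 ^- (k + n).+1 :> R.
    by rewrite exprS invfM mulrA mulfV ?mul1r.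
  have := du (k + n)%N; rewrite addSn => ? ? ?; lra.
have [N NP] := exp2N_small (divr_gt0 e0 (ltr0Sn R 3)).
have near n : (N <= n)%N -> d (u N) (u n) < e / 2.
  move=> Nn; have := step N (n - N)%N; rewrite subnK//.
  have : 0 < 2 ^- n :> R by rewrite invr_gt0 exprn_gt0.
  by have := NP N (leqnn N) => ? ? ?; lra.
exists N => m n /near Nm /near Nn.
have := is_metric_triangle dm (u m) (u N) (u n).
rewrite (is_metric_sym dm (u m) (u N)) => ?; lra.
Qed.

Section Main.
Variables (R : realType) (tau : structure R) (s : srm tau).
Hypothesis tau_emb : embedding_continuous tau.
Hypothesis tau_usc : upper_semicontinuous tau.
Hypothesis s_complete : srm_complete s.
Implicit Types (x y z : triple tau).

Let large_index (r e : R) N : 0 < e ->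
  exists k, [/\ (N <= k)%N, r <= k%:R & k.+1%:R^-1 < e].
Proof.
move=> e0; have [M _ MP] := near_infty_natSinv_lt (PosNum e0).
exists (maxn N (maxn M (Num.truncn r).+1)).
rewrite leq_maxl; split => //; last by apply: MP => /=; rewrite !leq_max leqnn orbT.
apply: le_trans (ltW (truncnS_gt r)) _.
by rewrite ler_nat !leq_max leqnn !orbT.
Qed.

(** A subsequence converges uniformly on balls. Both inclusions between the range of its limit and
    [A] follow by approximation, the two sets being closed; embedding continuity identifies the
    image of [a]. *)
Lemma iso_emb_limit (X Z : bcm R) (x0 : X) (z0 : Z) (h : nat -> iso_emb X Z)
    (A : set Z) (a : tau X) (b : tau Z) :
  (forall n, h n x0 = z0) -> closed A -> loc_cvg z0 (fun n => range (h n)) A ->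
  (forall e : R, 0 < e -> exists N, forall n, (N <= n)%N ->
     srm_dist s z0 (structure_map tau (h n) a) b < e) ->
  exists g : iso_emb X Z, [/\ g x0 = z0, range g = A & structure_map tau g a = b].
Proof.
move=> h0 cA hA hb; have [g [k_ [g0 k_ge kP]]] := iso_emb_subseq h0.
exists g; split => //.
  apply/seteqP; split => [_ [x _ <-]|z Az].
    move/closed_mdistP : cA; apply => e e0; have e20 : 0 < e / 2 by rewrite divr_gt0.
    have [N NP] := hA (mdist x0 x) _ e20.
    have [k [Nk xk ke]] := large_index (mdist x0 x) N e20.
    have [hkA _] := NP _ (leq_trans Nk (k_ge k)).
    have [|y Ay xy] := hkA (h (k_ k) x).
      by split; [exists x|rewrite /cball /= -(h0 (k_ k)) iso_emb_mdist].
    exists y => //; have := kP k x xk.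
    have := metric_triangle (g x) (h (k_ k) x) y; move: ke.
    by move: (k.+1%:R^-1) => q ? ? ?; lra.
  have /closed_mdistP := @closed_range_iso_emb R _ _ g; apply => e e0.
  (* The cap at 1 bounds the radius of the approximating point by [mdist z0 z + 1], which places it
     in the ball where [g] and the subsequence are compared. *)
  have e20 : 0 < Num.min (e / 2) 1 by rewrite lt_min divr_gt0//= ltr01.
  have [N NP] := hA (mdist z0 z) _ e20.
  have [k [Nk zk ke]] := large_index (mdist z0 z + 1) N e20.
  have [_ /(_ z)[|_ [x _ <-] zx]] := NP _ (leq_trans Nk (k_ge k)).
    by split; rewrite /cball /=.
  exists (g x); first by exists x.
  move: zx ke; rewrite le_min lt_min => /andP[zx zx1] /andP[ke ke1].
  have xk : mdist x0 x <= k%:R.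
    apply: le_trans zk; rewrite -(iso_emb_mdist (h (k_ k))) h0.
    by have := metric_triangle z0 z (h (k_ k) x) => ?; lra.
  have := kP k x xk; have := metric_triangle z (h (k_ k) x) (g x).
  rewrite (metric_sym (g x)); move: ke.
  by move: (k.+1%:R^-1) => q ? ? ?; lra.
have /(metric_cvgP _ _ (srm_metric s z0) (srm_topology s z0)) cg :
    (fun k => structure_map tau (h (k_ k)) a) @ \oo --> structure_map tau g a.
  by apply: tau_emb; exact: iso_emb_cvg_uniform kP.
apply/(is_metric_eq0 (srm_metric s z0))/eqP.
rewrite eq_le (is_metric_ge0 (srm_metric s z0)) andbT.
apply/ler_addgt0Pr => e e0; have e20 : 0 < e / 2 by rewrite divr_gt0.
have [N1 NP1] := cg _ e20; have [N2 NP2] := hb _ e20.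
have := NP1 _ (leq_maxl N1 N2).
have := NP2 _ (leq_trans (leq_maxr N1 N2) (k_ge (maxn N1 N2))).
set c := structure_map tau (h _) a => cb cg'.
have := is_metric_triangle (srm_metric s z0) (structure_map tau g a) c b.
rewrite (is_metric_sym (srm_metric s z0) _ c) => ?; lra.
Qed.

(** Each embedding factors through the other, and the two factors are inverse because [g] and [g']
    are injective; injectivity of the structure map of [g'] matches the points. *)
Lemma tequiv_of_ranges x y (Z : bcm R) (z0 : Z) (g : iso_emb (tspace x) Z)
    (g' : iso_emb (tspace y) Z) :
  g (troot x) = z0 -> g' (troot y) = z0 -> range g = range g' ->
  structure_map tau g (tpoint x) = structure_map tau g' (tpoint y) -> tequiv x y.
Proof.
move=> g0 g'0 gg' gpt.
have [k kP] : exists k : iso_emb (tspace x) (tspace y), forall a, g' (k a) = g a.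
  by apply: iso_emb_factor; rewrite gg'.
have [k' k'P] : exists k : iso_emb (tspace y) (tspace x), forall a, g (k a) = g' a.
  by apply: iso_emb_factor; rewrite gg'.
exists k; split.
- exists k' => a; first by apply: (@iso_emb_inj R _ _ g); rewrite k'P kP.
  by apply: (@iso_emb_inj R _ _ g'); rewrite kP k'P.
- by apply: (@iso_emb_inj R _ _ g'); rewrite kP g0.
- apply: (topological_embedding_inj (structure_embedding tau g')).
  by rewrite -gpt -structure_map_comp; congr structure_map; exact: iso_emb_eq.
Qed.

Let exp4N_lt n : 2 ^- n * 2 ^- n <= 2 ^- n :> R.
Proof.
rewrite ler_piMr ?invr_ge0 ?exprn_ge0//.
by rewrite invf_le1 ?exprn_gt0// exprn_ege1// ler1n.
Qed.

Lemma close_limit (x : nat -> triple tau) :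
  (forall n, close s (x n) (x n.+1) (2 ^- n * 2 ^- n)) ->
  exists (Z : bcm R) (z0 : Z) (f : forall n, iso_emb (tspace (x n)) Z)
    (A : set Z) (b : tau Z),
  [/\ forall n, f n (troot (x n)) = z0, closed A /\ A z0,
      loc_cvg z0 (fun n => range (f n)) A &
      forall e : R, 0 < e -> exists N, forall n, (N <= n)%N ->
        srm_dist s z0 (structure_map tau (f n) (tpoint (x n))) b < e].
Proof.
move=> xx; have [|Z [z0 [f [f0 _ fs fC]]]] := close_gluing xx.
  by exists 0%N.
have [|b bP] := geometric_cvg (srm_metric s z0)
  (u := fun n => structure_map tau (f n) (tpoint (x n))) (@s_complete Z z0).
  by move=> n; exact: lt_le_trans (fs n) (exp4N_lt n).
exists Z, z0, f, (loc_limit (fun n => range (f n))), b; split => //.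
- split; first exact: closed_loc_limit.
  by apply: loc_limit_mem => n; exists (troot (x n)).
- exact: loc_limit_cvg.
Qed.

(** Needed for an alternating sequence, whose terms equal [x] or [y] only up to a proof. *)
Let iso_emb_cast x y (Z : bcm R) (f : iso_emb (tspace y) Z) : y = x ->
  exists h : iso_emb (tspace x) Z, [/\ h (troot x) = f (troot y), range h = range f &
    structure_map tau h (tpoint x) = structure_map tau f (tpoint y)].
Proof. by move=> yx; subst y; exists f. Qed.

Lemma close_tequiv x y : (forall e : R, 0 < e -> close s x y e) -> tequiv x y.
Proof.
move=> xy; pose t n := if odd n then y else x.
have [|Z [z0 [f [A [b [f0 [cA _] fA fb]]]]]] := @close_limit t.
  move=> n; rewrite /t /=; case: (odd n) => /=; last exact: xy.
  exact/close_sym/xy.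
(* To be used with the even indices for [x] and the odd ones for [y]; both subsequences have the
   same limits [A] and [b]. *)
have sub w (i : nat -> nat) : (forall n, (n <= i n)%N) -> (forall n, t (i n) = w) ->
    exists g : iso_emb (tspace w) Z,
    [/\ g (troot w) = z0, range g = A & structure_map tau g (tpoint w) = b].
  move=> i_ge ti; have hP n := iso_emb_cast (f (i n)) (ti n).
  have [h {}hP] := choice hP.
  apply: (@iso_emb_limit _ _ (troot w) z0 h) => //.
  - by move=> n; have [-> _ _] := hP n.
  - move=> r e e0; have [N NP] := fA r e e0; exists N => n Nn.
    by have [_ -> _] := hP n; exact: NP (leq_trans Nn (i_ge n)).
  - move=> e e0; have [N NP] := fb e e0; exists N => n Nn.
    by have [_ _ ->] := hP n; exact: NP (leq_trans Nn (i_ge n)).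
have [||g [g0 gA gb]] := sub x double.
- by move=> n; rewrite -addnn leq_addr.
- by move=> n; rewrite /t odd_double.
have [||g' [g'0 g'A g'b]] := sub y (fun n => n.*2.+1).
- by move=> n; rewrite -addnn ltnW// ltnS leq_addr.
- by move=> n; rewrite /t /= odd_double.
by apply: (tequiv_of_ranges g0 g'0); rewrite ?gA ?g'A// gb.
Qed.

Lemma close_complete (x : nat -> triple tau) :
  (forall n, close s (x n) (x n.+1) (2 ^- n * 2 ^- n)) ->
  exists y, forall e : R, 0 < e ->
    exists N, forall n, (N <= n)%N -> close s (x n) y e.
Proof.
move=> /close_limit[Z [z0 [f [A [b [f0 [cA Az0] fA fb]]]]]].
have A0 : A !=set0 by exists z0.
pose i := sub_bcm_val cA A0; have iA : range i = A by exact: range_sub_bcm_val.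
have [y0 _ iy0] : range i z0 by rewrite iA.
have [a _ ab] : range (structure_map tau i) b.
  apply: (@tau_usc Z (fun n => tspace (x n)) _ f i _ (fun n => tpoint (x n))).
    apply: (loc_cvg_fell (z0 := z0)) => r e e0.
    by have [N NP] := fA r e e0; exists N => n /NP; rewrite /= iA.
  exact/(metric_cvgP _ _ (srm_metric s z0) (srm_topology s z0)).
exists (Triple y0 a) => e e0; have [N1 NP1] := fb e e0.
have [|N2 NP2] := dF_cvg _ cA fA e0; first by move=> n; exact: closed_range_iso_emb.
exists (maxn N1 N2) => n; rewrite geq_max => /andP[n1 n2].
exists Z, (f n), i; rewrite f0 iy0; split => //.
- by rewrite iA; exact: NP2.
- by rewrite /= ab; exact: NP1.
Qed.

Lemma tequiv_close x y (e : R) : tequiv x y -> 0 < e -> close s x y e.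
Proof.
move=> [f [[f' fK f'K] f0 fpt]] e0; exists (tspace y), f, (iso_emb_id _).
rewrite structure_map_id fpt (is_metric_eq0 (srm_metric s _) _ _).2//; split => //.
have -> : range f = range (iso_emb_id (tspace y)).
  by apply/seteqP; split => [_ [a _ <-]|a _]; [exists (f a)|exists (f' a)].
by rewrite dFxx.
Qed.

(** Equivalence amounts to closeness for every positive [e], so the laws of an equivalence relation
    are read off those of [close]. *)
Lemma tequiv_refl x : tequiv x x.
Proof. by apply: close_tequiv => e e0; exact: close_refl. Qed.

Lemma tequiv_sym x y : tequiv x y -> tequiv y x.
Proof. by move=> xy; apply: close_tequiv => e e0; exact/close_sym/tequiv_close. Qed.

Lemma tequiv_trans x y z : tequiv x y -> tequiv y z -> tequiv x z.
Proof.
move=> xy yz; apply: close_tequiv => e e0; have e20 : 0 < e / 2 by rewrite divr_gt0.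
by rewrite [e]splitr; apply: close_triangle (tequiv_close xy e20) (tequiv_close yz e20).
Qed.

Lemma tequiv_frakM (c : frakM tau) x : frakM_class c x -> tequiv (frakM_repr c) x.
Proof. by rewrite /frakM_repr; case: cid => y /= ->. Qed.

Lemma frakM_eq (c1 c2 : frakM tau) :
  tequiv (frakM_repr c1) (frakM_repr c2) -> c1 = c2.
Proof.
rewrite /frakM_repr; case: cid => x xE; case: cid => y yE /= xy.
have xyE : tequiv x = tequiv y.
  apply/funext => z; apply/propext; split => h; last exact: tequiv_trans xy h.
  exact: tequiv_trans (tequiv_sym xy) h.
move: c1 c2 xE yE => [C1 P1] [C2 P2] /= E1 E2; subst C1 C2.
by move: P1 P2; rewrite xyE => P1 P2; congr FrakM; exact: Prop_irrelevance.
Qed.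

End Main.

(** * The complete metric on equivalence classes *)

Theorem theorem6p40 (R : realType) (tau : structure R) (s : srm tau) :
  embedding_continuous tau ->
  upper_semicontinuous tau ->
  srm_complete s ->
  exists d : frakM tau -> frakM tau -> R,
    [/\ forall x y, dfrakM s x y = (d x y)%:E, is_metric d & complete_metric d].
Proof.
move=> tau_emb tau_usc s_complete.
pose d (c1 c2 : frakM tau) : R := fine (dfrakM s c1 c2).
have dE c1 c2 : dfrakM s c1 c2 = (d c1 c2)%:E by rewrite fineK// dtriple_fin_num.
have dlt c1 c2 e : d c1 c2 < e <-> close s (frakM_repr c1) (frakM_repr c2) e.
  by rewrite -lte_fin -dE; exact: dtriple_lt.
have d_ge0 c1 c2 : 0 <= d c1 c2 by rewrite -lee_fin -dE dtriple_ge0.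
have d_sym_le c1 c2 : d c1 c2 <= d c2 c1.
  apply/ler_addgt0Pr => e e0; apply/ltW/dlt/close_sym/dlt.
  by rewrite ltrDl.
exists d; split => //.
  split => //.
  - move=> c1 c2; split => [d0|->].
      apply: (frakM_eq tau_emb s_complete); apply: (close_tequiv tau_emb s_complete).
      by move=> e e0; apply/dlt; rewrite d0.
    apply/eqP; rewrite eq_le d_ge0 andbT; apply/ler_addgt0Pr => e e0.
    by rewrite add0r; apply/ltW/dlt; exact: close_refl.
  - by move=> c1 c2; apply/eqP; rewrite eq_le !d_sym_le.
  - move=> c1 c2 c3; apply/ler_addgt0Pr => e e0.
    have e20 : 0 < e / 2 by rewrite divr_gt0.
    rewrite [e]splitr addrACA; apply/ltW/dlt.
    by apply: (@close_triangle _ _ _ _ (frakM_repr c2)); apply/dlt; rewrite ltrDl.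
move=> u uC; pose x n := frakM_repr (u n).
have NP k : exists N, forall m n, (N <= m)%N -> (N <= n)%N ->
    close s (x m) (x n) (2 ^- k * 2 ^- k).
  have [|N h] := uC (2 ^- k * 2 ^- k); first by rewrite mulr_gt0 ?invr_gt0 ?exprn_gt0.
  by exists N => m n Nm Nn; apply/dlt; exact: h.
have [N {}NP] := choice NP.
(* A running maximum puts both [phi k] and [phi k.+1] beyond [N k]; the second argument of [maxn]
   also gives [k <= phi k]. *)
pose phi k := \max_(i < k.+1) maxn (N i) i.
have phi_ge i k : (i <= k)%N -> (maxn (N i) i <= phi k)%N.
  by rewrite -ltnS => ik; exact: (leq_bigmax (F := fun i : 'I_k.+1 => maxn (N i) i)
    (Ordinal ik)).
have phiN i k : (i <= k)%N -> (N i <= phi k)%N.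
  by move=> /phi_ge; apply: leq_trans; rewrite leq_maxl.
have [|y yP] := close_complete tau_usc s_complete (x := x \o phi).
  by move=> k; apply: NP; apply: phiN.
have cP : exists z, tequiv y = tequiv z by exists y.
pose c := FrakM cP; exists c => e e0.
have e30 : 0 < e / 3 by rewrite divr_gt0.
(* The chosen representative of the class of [y] need not be [y] itself. *)
have cy : close s y (frakM_repr c) (e / 3).
  apply: close_sym; apply: tequiv_close e30; apply: tequiv_frakM => /=.
  exact: tequiv_refl.
have [M MP] := yP _ e30; have [K KP] := uC _ e30.
exists K => n Kn; apply/dlt.
(* The three errors: from [u n] to the extracted term of index [maxn M K], from there to [y], and
   from [y] to the representative of its class. *)
have -> : e = e / 3 + e / 3 + e / 3 by lra.
apply: close_triangle cy; apply: close_triangle (MP _ (leq_maxl M K)).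
apply/dlt; apply: KP => //=.
apply: leq_trans (leq_maxr M K) _; apply: leq_trans (phi_ge _ _ (leqnn _)).
exact: leq_maxr.
Qed.
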